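(* Let $S$ be a Polish space with Borel $\sigma$-algebra $\mathcal{B}(S)$, and let $R\subseteq S\times S$ be a reflexive, transitive relation which is an $F_\sigma$ subset of $S\times S$. Then for any Borel probability measures $\mu,\nu$ on $S$, \[ \max_{A\in R^{\ast}}\big(\mu(A)-\nu(A)\big)=\inf_{\pi\in\Pi(\mu,\nu)}\big(1-\pi(R)\big), \] where in particular the supremum on the left-hand side is attained by some $A\in R^\ast$. Moreover, the infimum on the right-hand side need not be attained: there exist a Polish space $S$, a reflexive transitive $F_\sigma$ relation $R$ on $S$, and Borel probability measures $\mu,\nu$ on $S$ for which no $\pi\in\Pi(\mu,\nu)$ achieves the infimum.
   Context: A coupling of Borel probability measures $\mu,\nu$ on $S$ is a Borel probability measure $\pi$ on $S\times S$ with $\pi(\,\cdot\,\times S)=\mu$ and $\pi(S\times\,\cdot\,)=\nu$; $\Pi(\mu,\nu)$ denotes the set of all couplings. The relation $R$ is reflexive if $(x,x)\in R$ for all $x$, transitive if $(x,y),(y,z)\in R$ imply $(x,z)\in R$, and $F_\sigma$ if it is a countable union of closed subsets of $S\times S$. The collection $R^\ast$ is defined by $R^{\ast}:=\{A\in\mathcal B(S):\text{ if }x\in A\text{ and }(x,y)\in R\text{ then }y\in A\}$. *)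

(* Defs.v *)
From HB Require Import structures.
From mathcomp Require Import all_boot all_order all_algebra.
From mathcomp Require Import all_classical all_reals all_analysis.
From mathcomp Require Import borel_hierarchy.
Set Implicit Arguments. Unset Strict Implicit. Unset Printing Implicit Defensive.
Import Order.TTheory GRing.Theory Num.Theory.
Local Open Scope classical_set_scope.
Local Open Scope ring_scope.

Definition separable_space (T : topologicalType) : Prop :=
  exists D : set T, countable D /\ dense D.

Definition completely_metrizable (R : realType) (T : topologicalType) : Prop :=
  exists d : T -> T -> R,
    [/\ (forall x y, d x y = 0 <-> x = y),
        (forall x y, d x y = d y x),
        (forall x y z, d x z <= d x y + d y z),
        (forall A : set T, open A <->
           (forall x, A x -> exists2 e : R, 0 < e & [set y | d x y < e] `<=` A))
      & (forall u : nat -> T,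
           (forall e : R, 0 < e -> exists N : nat, forall m n : nat,
               (N <= m)%N -> (N <= n)%N -> d (u m) (u n) < e) ->
           exists x : T, forall e : R, 0 < e -> exists N : nat, forall n : nat,
               (N <= n)%N -> d (u n) x < e)].

Definition polish (R : realType) (T : topologicalType) : Prop :=
  separable_space T /\ completely_metrizable R T.

Definition pprod (S : ptopologicalType) := (S * S)%type.
HB.instance Definition _ (S : ptopologicalType) := Topological.on (pprod S).
HB.instance Definition _ (S : ptopologicalType) := Pointed.on (pprod S).

Definition borel (T : ptopologicalType) := g_sigma_algebraType (@open T).

Definition rel_reflexive (S : Type) (Rel : set (S * S)) : Prop :=
  forall x, Rel (x, x).

Definition rel_transitive (S : Type) (Rel : set (S * S)) : Prop :=
  forall x y z, Rel (x, y) -> Rel (y, z) -> Rel (x, z).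

Definition Rstar (S : ptopologicalType) (Rel : set (S * S)) : set (set S) :=
  [set A | measurable (A : set (borel S)) /\
           (forall x y, A x -> Rel (x, y) -> A y)].

Definition coupling (R : realType) (S : ptopologicalType)
    (mu nu : probability (borel S) R)
    (pi : probability (borel (pprod S)) R) : Prop :=
  (forall A : set S, measurable (A : set (borel S)) ->
     pi (A `*` [set: S]) = mu A) /\
  (forall B : set S, measurable (B : set (borel S)) ->
     pi ([set: S] `*` B) = nu B).

Definition couplings (R : realType) (S : ptopologicalType)
    (mu nu : probability (borel S) R) :
    set (probability (borel (pprod S)) R) :=
  [set pi | coupling mu nu pi].

(* Main.v *)
Require Import Defs.
From HB Require Import structures.
From mathcomp Require Import all_boot all_order all_algebra.
From mathcomp Require Import all_classical all_reals all_analysis.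
From mathcomp Require Import borel_hierarchy measurable_realfun.
From mathcomp Require Import ring lra.
Set Implicit Arguments. Unset Strict Implicit. Unset Printing Implicit Defensive.
Import Order.TTheory GRing.Theory Num.Theory.
Import numFieldNormedType.Exports.
Local Open Scope classical_set_scope.
Local Open Scope ring_scope.

(** Write [psi (A, V) = mu A - nu V] for pairs of Borel sets with [F[A] <= V].

    For closed [F], a coupling with [1 - pi F <= sup psi] is a limit of couplings
    built from finite partitions of small mesh: on a finite partition the bound is
    a Hall-type transport theorem, the limit is taken along an ultrafilter, and the
    resulting finitely additive set function on rectangles is countably additive
    because its marginals are tight.

    For [Rel] the increasing union of closed [F n], take nearly optimal pairs for
    each [F n]. As [psi] is modular and pairs are stable under unions and
    intersections, their limit superior [(U, V)] is a [Rel]-pair whose [psi] is at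
    least the limit of the suprema. Choosing a sigma-compact [K <= U] of full
    [mu]-measure, [Rel[K]] is an F-sigma set in [Rel^*] lying between [K] and [V],
    hence optimal.

    For the failure of attainment, move the uniform law on [[0, 1]] to [[2, 3]]
    under the requirement that every point moves by strictly more than [2]: the
    infimum is [0], but a coupling with this property almost surely would make the
    second marginal strictly larger, while the two laws agree up to translation. *)

(** * Transport on finite sets *)

Section finite_transport.
(* The classical-set lemmas loaded above shadow the finite-set ones. *)
Import mathcomp.boot.fintype mathcomp.boot.finset.
Local Close Scope classical_set_scope.
Variable R : realFieldType.

Definition neighbours (I J : finType) (E : {set I * J}) (A : {set I}) : {set J} :=
  [set j | [exists i in A, (i, j) \in E]].

Lemma neighboursP (I J : finType) (E : {set I * J}) (A : {set I}) j :
  reflect (exists2 i, i \in A & (i, j) \in E) (j \in neighbours E A).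
Proof.
rewrite inE; apply: (iffP existsP) => [[i /andP[]]|[i iA ij]]; exists i => //.
by rewrite iA.
Qed.

Lemma ler_sum_subset (J : finType) (b : J -> R) (X Y : {set J}) :
  (forall j, 0 <= b j) -> X \subset Y -> \sum_(j in X) b j <= \sum_(j in Y) b j.
Proof.
move=> b0 XY; rewrite [leRHS](big_setID X)/= (setIidPr XY) lerDl.
exact: sumr_ge0.
Qed.

Lemma sum_setUI (J : finType) (b : J -> R) (X Y : {set J}) :
  \sum_(j in X :|: Y) b j + \sum_(j in X :&: Y) b j =
  \sum_(j in X) b j + \sum_(j in Y) b j.
Proof.
rewrite (big_setID X)/= setUK setDUl setDv set0U -addrA; congr (_ + _).
by rewrite [in RHS](big_setID X)/= setIC addrC.
Qed.

Lemma sum_shift_at (J : finType) (b : J -> R) (t : R) j0 (X : {set J}) :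
  \sum_(j in X) (b j - (if j == j0 then t else 0)) =
  \sum_(j in X) b j - (if j0 \in X then t else 0).
Proof.
rewrite sumrB; congr (_ - _); rewrite -big_mkcondr/=.
case: ifPn => jX; last by rewrite big1// => j /andP[+ /eqP jj]; rewrite jj (negbTE jX).
rewrite (big_pred1 j0)// => j /=.
by case: eqP => [->|]; rewrite ?andbF// jX.
Qed.

(** The witness is the smaller of [m] and the minimum of [h] over [P], so an empty [P] is allowed.
    The final disjunction records which constraint is binding. *)
Lemma finite_min_le (T : finType) (P : pred T) (h : T -> R) (m : R) :
  0 <= m -> (forall A, P A -> 0 <= h A) ->
  exists t, [/\ 0 <= t, t <= m, forall A, P A -> t <= h A &
    t = m \/ exists2 A, P A & h A = t].
Proof.
move=> m0 h0; have [A0 /andP[PA0 hA0]|no] := pickP (fun A => P A && (h A <= m)).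
  case: (arg_minP h PA0) => A PA hA; exists (h A); split => //; first exact: h0.
  - exact: le_trans (hA _ PA0) hA0.
  - by right; exists A.
exists m; split => //; last by left.
by move=> A PA; have := no A; rewrite PA/= => /negbT; rewrite -ltNge => /ltW.
Qed.

(* Push the largest mass [t] along an edge that keeps Hall's condition valid;
   afterwards an endpoint is exhausted or a tight set appears, and in either case
   the edge can be deleted: in the latter by submodularity of the neighbourhood
   weight. *)
Lemma hall_transport (I J : finType) (E : {set I * J}) (a : I -> R) (b : J -> R) :
  (forall i, 0 <= a i) -> (forall j, 0 <= b j) ->
  (forall A : {set I}, \sum_(i in A) a i <= \sum_(j in neighbours E A) b j) ->
  exists p : I -> J -> R,
    [/\ forall i j, 0 <= p i j, forall i j, (i, j) \notin E -> p i j = 0,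
        forall i, \sum_j p i j = a i & forall j, \sum_i p i j <= b j].
Proof.
have [n] := ubnP #|E|; elim: n => // n IH in E a b *.
rewrite ltnS => En a0 b0 hall.
have [E0|[[i0 j0] ijE]] := set_0Vmem E.
  exists (fun _ _ => 0); split => //.
  - move=> i; rewrite big1//; apply/eqP; rewrite eq_le a0/=.
    have := hall [set i]; rewrite big_set1 big1// => j /neighboursP[k _].
    by rewrite E0 inE.
  - by move=> j; rewrite big1.
(* [h A] is the slack in Hall's condition for [A]. Taking mass [t] away at both [i0] and [j0] lowers
   it exactly for the sets satisfying [P], which lose [t] on the neighbour side only. *)
pose h (A : {set I}) := \sum_(j in neighbours E A) b j - \sum_(i in A) a i.
pose P (A : {set I}) := (i0 \notin A) && (j0 \in neighbours E A).
have [||t [t0 tm th tE]] := @finite_min_le _ P h (Num.min (a i0) (b j0)).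
- by rewrite le_min a0 b0.
- by move=> A _; rewrite subr_ge0.
have ta : t <= a i0 by rewrite (le_trans tm)// ge_min lexx.
have tb : t <= b j0 by rewrite (le_trans tm)// ge_min lexx orbT.
pose a' i := a i - (if i == i0 then t else 0).
pose b' j := b j - (if j == j0 then t else 0).
have a'0 i : 0 <= a' i by rewrite /a'; case: eqP => [->|_]; rewrite ?subr_ge0// subr0.
have b'0 j : 0 <= b' j by rewrite /b'; case: eqP => [->|_]; rewrite ?subr_ge0// subr0.
have hall1 (B : {set I}) : \sum_(i in B) a' i <= \sum_(j in neighbours E B) b' j.
  rewrite !sum_shift_at; have := hall B; case: ifPn => iB.
    have -> : j0 \in neighbours E B by apply/neighboursP; exists i0.
    lra.
  case: ifPn => jB; last lra.
  by move=> _; rewrite subr0 lerBrDr addrC -lerBrDr; apply: th; rewrite /P iB.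
pose E' := E :\ (i0, j0).
have nbrE' (B : {set I}) : i0 \notin B -> neighbours E' B = neighbours E B.
  move=> iB; apply/setP => j; apply/neighboursP/neighboursP => -[i iB' ij].
    by exists i => //; move: ij; rewrite !inE => /andP[].
  exists i => //; rewrite !inE ij andbT; apply: contra iB => /eqP[<- _] //.
have hall' (B : {set I}) : \sum_(i in B) a' i <= \sum_(j in neighbours E' B) b' j.
  have [iB|/negPn iB] := boolP (i0 \notin B); first by rewrite nbrE'.
  have caseA : t = a i0 -> \sum_(i in B) a' i <= \sum_(j in neighbours E' B) b' j.
    move=> tai; rewrite (big_setD1 i0)//= {1}/a' eqxx -tai subrr add0r.
    apply: (le_trans (hall1 _)); rewrite -nbrE' ?setD11//.
    apply: ler_sum_subset => //; apply/subsetP => j /neighboursP[i].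
    by move=> /setD1P[_ iB'] ij; apply/neighboursP; exists i.
  have caseB : t = b j0 -> \sum_(i in B) a' i <= \sum_(j in neighbours E' B) b' j.
    move=> tbj; apply: (le_trans (hall1 _)).
    apply: (@le_trans _ _ (\sum_(j in j0 |: neighbours E' B) b' j)).
      apply: ler_sum_subset => //; apply/subsetP => j /neighboursP[i iB' ij].
      rewrite in_setU1; have [//|/= jj] := eqVneq j j0.
      by apply/neighboursP; exists i => //; rewrite !inE ij andbT xpair_eqE (negbTE jj) andbF.
    have [jn|jn] := boolP (j0 \in neighbours E' B).
      by rewrite (setUidPr _)// sub1set.
    by rewrite big_setU1//= {1}/b' eqxx -tbj subrr add0r.
  case: tE => [|[A /andP[iA jA] hA]].
    by rewrite /Num.min; case: ifP => _.
  have tight : \sum_(j in neighbours E A) b' j = \sum_(i in A) a' i.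
    by rewrite !sum_shift_at jA (negbTE iA) -hA /h; lra.
  (* Since [j0] already lies in [Y], deleting the edge costs nothing in the union; since [i0] is not
     in [A], it costs nothing in the intersection. Hall's condition for both sets is added and the
     tight equality for [A] cancelled. *)
  set X := neighbours E' B; set Y := neighbours E A.
  have UXY : neighbours E (B :|: A) \subset X :|: Y.
    apply/subsetP => j /neighboursP[i]; rewrite !in_setU => /orP[iB'|iA'] ij.
      have [->|jj] := eqVneq j j0; first by rewrite jA orbT.
      apply/orP; left; apply/neighboursP; exists i => //.
      by rewrite !inE ij andbT xpair_eqE (negbTE jj) andbF.
    by apply/orP; right; apply/neighboursP; exists i.
  have IXY : neighbours E (B :&: A) \subset X :&: Y.
    rewrite -nbrE' ?inE ?(negbTE iA) ?andbF//.
    apply/subsetP => j /neighboursP[i]; rewrite in_setI => /andP[iB' iA'] ij.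
    rewrite in_setI; apply/andP; split; apply/neighboursP; exists i => //.
    by move: ij; rewrite !inE => /andP[].
  have := hall1 (B :|: A); have := hall1 (B :&: A).
  have := ler_sum_subset b'0 UXY; have := ler_sum_subset b'0 IXY.
  have := sum_setUI a' B A; have := sum_setUI b' X Y.
  rewrite -/Y in tight; rewrite tight; lra.
have [|//|//|//|p [p0 pE pa pb]] := IH E' a' b'.
  by rewrite (leq_trans _ En)// [leqRHS](cardsD1 (i0, j0)) ijE.
exists (fun i j => p i j + (if (i == i0) && (j == j0) then t else 0)); split.
- by move=> i j; rewrite addr_ge0//; case: ifP.
- move=> i j ij; rewrite pE ?inE ?(negbTE ij) ?andbF// add0r; case: ifP => // /andP[/eqP ii /eqP jj].
  by rewrite ii jj ijE in ij.
- move=> i; rewrite big_split/= pa /a'; have [->|_]/= := eqVneq i i0.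
    by rewrite -big_mkcond/= big_pred1_eq subrK.
  by rewrite big1// addr0 subr0.
- move=> j; rewrite big_split/=; have := pb j; rewrite /b'; have [->|_]/= := eqVneq j j0.
    under [X in _ -> _ + X <= _]eq_bigr do rewrite andbT.
    by rewrite -big_mkcond/= big_pred1_eq lerBrDr.
  move=> pbj; rewrite [X in _ + X]big1 => [|i _]; last by rewrite andbF.
  by rewrite addr0; rewrite subr0 in pbj.
Qed.

Lemma transport_defect (I J : finType) (E : {set I * J}) (a : I -> R) (b : J -> R) (c : R) :
  (forall i, 0 <= a i) -> (forall j, 0 <= b j) ->
  \sum_i a i = \sum_j b j -> 0 <= c ->
  (forall A : {set I}, \sum_(i in A) a i <= \sum_(j in neighbours E A) b j + c) ->
  exists p : I -> J -> R,
    [/\ forall i j, 0 <= p i j, forall i, \sum_j p i j = a i,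
        forall j, \sum_i p i j = b j &
        \sum_i \sum_(j | (i, j) \notin E) p i j <= c].
Proof.
move=> a0 b0 ab c0 hall.
pose E' : {set I * option J} := [set x | if x.2 is Some j then (x.1, j) \in E else true].
pose b' (j : option J) := if j is Some j then b j else c.
have sumO (F : option J -> R) (Q : pred (option J)) :
    \sum_(j | Q j) F j = (if Q None then F None else 0) + \sum_(j | Q (Some j)) F (Some j).
  rewrite big_mkcond (bigD1 None)//=; congr (_ + _).
  rewrite (@reindex_omap _ _ _ _ _ Some id)/=; last by case.
  by rewrite [RHS]big_mkcond; apply: eq_bigl => j; rewrite eqxx.
have [|A|p [p0 pE pa pb]] := @hall_transport I _ E' a b' a0.
- by case.
- have [->|[i iA]] := set_0Vmem A; first by rewrite big_set0 sumr_ge0 => [|[j|] _]; [|exact: b0|exact: c0].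
  rewrite sumO ifT; last by apply/neighboursP; exists i => //; rewrite inE.
  rewrite addrC; apply: (le_trans (hall A)); rewrite lerD2r le_eqVlt; apply/orP; left.
  by apply/eqP/eq_bigl => j; apply/neighboursP/neighboursP => -[k kA kE];
    exists k => //; move: kE; rewrite !inE.
have pN : \sum_i p i None <= c := pb None.
pose u := \sum_i p i None.
have paO i : \sum_j p i (Some j) = a i - p i None by have := pa i; rewrite sumO/=; lra.
have paT : \sum_j \sum_i p i (Some j) = \sum_j b j - u.
  by rewrite exchange_big/= -ab /u -sumrB; apply: eq_bigr => i _; rewrite paO.
pose k j := b j - \sum_i p i (Some j).
have k0 j : 0 <= k j by rewrite subr_ge0; exact: pb.
have ku : \sum_j k j = u by rewrite sumrB paT; lra.
have u0 : 0 <= u by apply: sumr_ge0.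
(* With nothing in the sink, equality of the total masses shows that every target is full. This case
   is separate because the general formula divides by [u]. *)
have [uZ|unz] := eqVneq u 0.
  have pZ i : p i None = 0.
    by apply: (@psumr_eq0P _ _ predT (fun i => p i None)).
  have kZ j : k j = 0 by apply: (@psumr_eq0P _ _ predT k) => //; rewrite ku.
  exists (fun i j => p i (Some j)); split => //.
  - by move=> i; rewrite paO pZ subr0.
  - by move=> j; have := kZ j; rewrite /k => /eqP; rewrite subr_eq0 => /eqP.
  - by rewrite big1// => i _; rewrite big1// => j ij; rewrite pE// inE.
(* The added term is the product coupling of the sink masses [p i None] and the residual capacities
   [k j], both of total mass [u]. *)
exists (fun i j => p i (Some j) + p i None * k j / u); split.
- by move=> i j; rewrite addr_ge0// divr_ge0// mulr_ge0.
- move=> i; rewrite big_split/= paO -mulr_suml -mulr_sumr ku mulfK// subrK//.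
- by move=> j; rewrite big_split/= -2!mulr_suml -/u mulrAC divff// mul1r /k addrC subrK.
- apply: le_trans pN; apply: ler_sum => i _.
  under eq_bigr => j ij do rewrite (pE i (Some j)) ?inE// add0r.
  rewrite -mulr_suml -mulr_sumr -mulrA ler_piMr//.
  rewrite ler_pdivrMr ?lt_def ?unz// mul1r -ku [leRHS](bigID (fun j => (i, j) \notin E))/=.
  by rewrite lerDl sumr_ge0.
Qed.

End finite_transport.

(** * Probabilities as real numbers, and uncrossing of pairs *)

Definition prob (d : measure_display) (T : measurableType d) (R : realType)
  (P : probability T R) (A : set T) : R := fine (P A).

Section real_valued_probability.
Context (d : measure_display) (T : measurableType d) (R : realType).
Variable P : probability T R.
Implicit Types A B : set T.

Lemma probE A : measurable A -> P A = (prob P A)%:E.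
Proof. by move=> mA; rewrite /prob fineK// fin_num_measure. Qed.

Lemma prob_ge0 A : 0 <= prob P A.
Proof. by rewrite fine_ge0. Qed.

Lemma prob_le1 A : measurable A -> prob P A <= 1.
Proof. by move=> mA; rewrite -lee_fin -probE// probability_le1. Qed.

Lemma probT : prob P setT = 1.
Proof. by rewrite /prob probability_setT. Qed.

Lemma prob_le A B : measurable A -> measurable B -> A `<=` B ->
  prob P A <= prob P B.
Proof. by move=> mA mB AB; rewrite -lee_fin -!probE// le_measure// inE. Qed.

Lemma probU A B : measurable A -> measurable B -> A `&` B = set0 ->
  prob P (A `|` B) = prob P A + prob P B.
Proof.
move=> mA mB AB; apply: EFin_inj; rewrite EFinD -!probE ?measureU//.
exact: measurableU.
Qed.

Lemma probC A : measurable A -> prob P (~` A) = 1 - prob P A.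
Proof.
move=> mA; have := probU mA (measurableC mA) (setICr A).
by rewrite setUCr probT => ->; rewrite addrC addKr.
Qed.

Lemma probID A B : measurable A -> measurable B ->
  prob P A = prob P (A `&` B) + prob P (A `\` B).
Proof.
move=> mA mB; rewrite -probU ?setUIDK//; [exact: measurableI|exact: measurableD|].
by rewrite setDE setIACA setICr setI0.
Qed.

Lemma probD A B : measurable A -> measurable B -> B `<=` A ->
  prob P (A `\` B) = prob P A - prob P B.
Proof. by move=> mA mB BA; rewrite (probID mA mB) (setIidr BA) addrC addKr. Qed.

Lemma probUI A B : measurable A -> measurable B ->
  prob P (A `|` B) + prob P (A `&` B) = prob P A + prob P B.
Proof.
move=> mA mB; rewrite (probID (measurableU _ _ mA mB) mA) setUK setDUl setDv set0U.
by rewrite [in RHS](probID mB mA) setIC; lra.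
Qed.

Lemma prob_le_U A B : measurable A -> measurable B ->
  prob P (A `|` B) <= prob P A + prob P B.
Proof. by move=> mA mB; rewrite -probUI// lerDl prob_ge0. Qed.

Lemma prob_bigcup_approx (F : (set T)^nat) (e : R) :
  (forall n, measurable (F n)) -> {homo F : n m / (n <= m)%N >-> n `<=` m} ->
  0 < e -> exists n, prob P (\bigcup_k F k) - e < prob P (F n).
Proof.
move=> mF ndF e0; have mU : measurable (\bigcup_k F k) by exact: bigcupT_measurable.
have := nondecreasing_cvg_mu (mu := P) mF mU.
have ndF' : nondecreasing_seq F by move=> n m nm; apply/subsetPset/ndF.
rewrite [X in _ --> X](probE mU) => /(_ ndF')/fine_cvg/cvgr_gt/= /(_ (prob P (\bigcup_k F k) - e)).
rewrite ltrBlDr ltrDl => /(_ e0)[n _ /(_ n (leqnn n))]; exists n => //.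
Qed.

Lemma prob_bigcap_approx (F : (set T)^nat) (e : R) :
  (forall n, measurable (F n)) -> {homo F : n m / (n <= m)%N >-> m `<=` n} ->
  0 < e -> exists n, prob P (F n) < prob P (\bigcap_k F k) + e.
Proof.
move=> mF niF e0; have [||//|n] := @prob_bigcup_approx (fun n => ~` F n) e.
- by move=> n; exact: measurableC.
- by move=> n m nm; apply: subsetC; exact: niF.
rewrite -setC_bigcap probC ?probC//; last exact: bigcapT_measurable.
by exists n; lra.
Qed.

Lemma prob_bigcup_le (F : (set T)^nat) (c : R) :
  (forall n, measurable (F n)) -> {homo F : n m / (n <= m)%N >-> n `<=` m} ->
  (forall n, prob P (F n) <= c) -> prob P (\bigcup_k F k) <= c.
Proof.
move=> mF ndF Fc; apply/ler_addgt0Pr => e e0.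
have [n] := prob_bigcup_approx mF ndF e0; have := Fc n; lra.
Qed.

End real_valued_probability.

(** [V] is any Borel set containing the image of [A]: the image itself need not be Borel, and the
    slack makes pairs stable under intersection. *)
Definition rel_pair (S : ptopologicalType) (F : set (S * S)) (A V : set S) : Prop :=
  [/\ measurable (A : set (borel S)), measurable (V : set (borel S)) &
      forall x y, A x -> F (x, y) -> V y].

Section uncrossing.
Context (R : realType) (S : ptopologicalType) (mu nu : probability (borel S) R).
Local Notation psi A V := (prob mu A - prob nu V).

(** Peeling off the smallest index leaves a union that starts at [k.+1], which suits an induction
    where errors shrink with the starting index. *)
Fixpoint union_from (A : nat -> set S) (k l : nat) : set S :=
  if l is l'.+1 then A k `|` union_from A k.+1 l' else A k.

Lemma union_fromP A k l x :
  union_from A k l x <-> exists j, [/\ (k <= j)%N, (j <= k + l)%N & A j x].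
Proof.
elim: l k => [|l IH] k /=.
  rewrite addn0; split => [|[j [kj jk Ajx]]]; first by exists k.
  by have -> : k = j by apply/eqP; rewrite eqn_leq kj.
split=> [[Akx|/IH[j [kj jl Ajx]]]|[j [kj jl Ajx]]].
- by exists k; split => //; rewrite leq_addr.
- by exists j; split => //; [exact: ltnW|rewrite addnS].
- move: kj; rewrite leq_eqVlt => /predU1P[->|kj]; first by left.
  by right; apply/IH; exists j; split => //; rewrite addSnnS.
Qed.

Lemma rel_pairU (F : set (S * S)) (A V A' V' : set S) :
  rel_pair F A V -> rel_pair F A' V' -> rel_pair F (A `|` A') (V `|` V').
Proof.
move=> [mA mV h] [mA' mV' h']; split; [exact: measurableU|exact: measurableU|].
by move=> x y [Ax|Ax] xy; [left; exact: h xy|right; exact: h' xy].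
Qed.

Lemma rel_pairI (F : set (S * S)) (A V A' V' : set S) :
  rel_pair F A V -> rel_pair F A' V' -> rel_pair F (A `&` A') (V `&` V').
Proof.
move=> [mA mV h] [mA' mV' h']; split; [exact: measurableI|exact: measurableI|].
by move=> x y [Ax Ax'] xy; split; [exact: h xy|exact: h' xy].
Qed.

Lemma rel_pair_sub (F G : set (S * S)) (A V : set S) : F `<=` G -> rel_pair G A V -> rel_pair F A V.
Proof. by move=> FG [mA mV h]; split => // x y Ax /FG; exact: h. Qed.

(* [psi] is modular and pairs form a lattice, so a union of nearly optimal pairs
   is nearly optimal; with summable errors this survives in the limit superior. *)
Lemma limsup_rel_pair (G : nat -> set (S * S)) (c : R) (A V : nat -> set S) :
  {homo G : n m / (n <= m)%N >-> n `<=` m} ->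
  (forall k B W, rel_pair (G k) B W -> psi B W <= c + 2^-1 ^+ k) ->
  (forall k, rel_pair (G k) (A k) (V k)) ->
  (forall k, c - 2^-1 ^+ k <= psi (A k) (V k)) ->
  rel_pair (\bigcup_k G k) (lim_sup_set A) (lim_sup_set V) /\
  c <= psi (lim_sup_set A) (lim_sup_set V).
Proof.
move=> ndG ubG pairAV lbAV.
have mA k : measurable (A k : set (borel S)) by have [] := pairAV k.
have mV k : measurable (V k : set (borel S)) by have [] := pairAV k.
have mT (B : nat -> set S) k : (forall k, measurable (B k : set (borel S))) ->
    measurable (\bigcup_(j >= k) B j : set (borel S)).
  by move=> mB; apply: bigcup_measurable => j _.
have pairU k l : rel_pair (G k) (union_from A k l) (union_from V k l).
  elim: l k => [|l IH] k //=; apply: rel_pairU => //.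
  by apply: rel_pair_sub (IH _); exact: ndG.
(* The constant 4 reproduces itself: a step loses [2^-1 ^+ k] for the pair at [k], another
   [2^-1 ^+ k] for the bound on the intersection, and [4 * 2^-1 ^+ k.+1] for the rest. *)
have psiU k l : c - 4 * 2^-1 ^+ k <= psi (union_from A k l) (union_from V k l).
  elim: l k => [|l IH] k /=.
    by have := lbAV k; have : 0 <= (2^-1 : R) ^+ k by []; lra.
  have pk := rel_pair_sub (ndG _ _ (leqnSn k)) (pairU k.+1 l).
  have := ubG _ _ _ (rel_pairI (pairAV k) pk); have := lbAV k; have := IH k.+1.
  have [mA' mV' _] := pk.
  have := probUI mu (mA k) mA'; have := probUI nu (mV k) mV'.
  rewrite exprS; lra.
have ndU (B : nat -> set S) k :
    {homo union_from B k : n m / (n <= m)%N >-> n `<=` m}.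
  move=> n m nm x /union_fromP[j [kj jn Bj]]; apply/union_fromP; exists j.
  by split => //; apply: (leq_trans jn); rewrite leq_add2l.
have UE (B : nat -> set S) k : \bigcup_l union_from B k l = \bigcup_(j >= k) B j.
  apply/seteqP; split => [x [l _ /union_fromP[j [kj _ Bj]]]|x [j /= kj Bj]].
    by exists j.
  by exists (j - k)%N => //; apply/union_fromP; exists j; split => //; rewrite subnKC.
have psiT k : c - 4 * 2^-1 ^+ k <= psi (\bigcup_(j >= k) A j) (\bigcup_(j >= k) V j).
  have : prob nu (\bigcup_(j >= k) V j) <= prob mu (\bigcup_(j >= k) A j) - (c - 4 * 2^-1 ^+ k).
    rewrite -(UE V); apply: prob_bigcup_le => [l||l]; [by have [] := pairU k l|exact: ndU|].
    have [mU _ _] := pairU k l.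
    have : prob mu (union_from A k l) <= prob mu (\bigcup_(j >= k) A j).
      by apply: prob_le => //; [exact: mT|rewrite -UE; exact: bigcup_sup].
    have := psiU k l; lra.
  lra.
have niT (B : nat -> set S) :
    {homo (fun n => \bigcup_(j >= n) B j) : n m / (n <= m)%N >-> m `<=` n}.
  by move=> n m nm x [j /= mj Bj]; exists j => //=; exact: leq_trans mj.
have mL (B : nat -> set S) : (forall k, measurable (B k : set (borel S))) ->
    measurable (lim_sup_set B : set (borel S)).
  by move=> mB; apply: bigcapT_measurable => k; exact: mT.
split.
  split; [exact: mL|exact: mL|move=> x y Ax [k _ Gk] n _].
  (* An index beyond both [n] and [k] puts [x] in [A j] and [(x, y)] in [G j] at the same time. *)
  have [j /= nj Aj] := Ax (maxn n k) I; exists j => /=.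
    by apply: leq_trans nj; rewrite leq_maxl.
  have [_ _ h] := pairAV j; apply: h Aj _; apply: ndG Gk.
  by apply: leq_trans nj; rewrite leq_maxr.
apply/ler_addgt0Pr => e e0; have e30 : 0 < e / 2 by rewrite divr_gt0.
have [n hn] := prob_bigcap_approx nu (fun k => mT V k mV) (niT V) e30.
have [n1 hn1] := prob_bigcap_approx mu (fun k => mT A k mA) (niT A) e30.
have [N hN] : exists N, 4 * (2^-1 : R) ^+ N < e / 2.
  have : (fun n => (2^-1 : R) ^+ n) @ \oo --> (0 : R) by apply: cvg_expr; rewrite ger0_norm//; lra.
  move=> /cvgr_lt /(_ (e / 8)); case; first by rewrite divr_gt0.
  by move=> N _ /(_ N (leqnn N)) /= h; exists N; lra.
(* From [n1] on, the tails of [A] have nearly the [mu]-measure of the limit superior, while [nu] of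
   the limit superior of [V] is at most that of every tail. *)
pose m := maxn N n1.
have := psiT m; have : 4 * (2^-1 : R) ^+ m <= 4 * (2^-1) ^+ N.
  by rewrite ler_pM2l// ler_wiXn2l// ?leq_maxl//; lra.
have := prob_le mu (mT A m mA) (mT A n1 mA) (niT A _ _ (leq_maxr N n1)).
have : prob nu (lim_sup_set V) <= prob nu (\bigcup_(j >= m) V j).
  by apply: prob_le; [exact: mL|exact: mT|apply: bigcap_inf].
rewrite -/(lim_sup_set A) in hn1; lra.
Qed.

End uncrossing.

(** * Borel probabilities on a Polish space *)

(** The conditions under the existential in [completely_metrizable], isolated so that one metric can
    be fixed throughout. *)
Definition complete_metric (R : realType) (T : topologicalType) (d : T -> T -> R) : Prop :=
  [/\ (forall x y, d x y = 0 <-> x = y),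
      (forall x y, d x y = d y x),
      (forall x y z, d x z <= d x y + d y z),
      (forall A : set T, open A <->
         (forall x, A x -> exists2 e : R, 0 < e & [set y | d x y < e] `<=` A))
    & (forall u : nat -> T,
         (forall e : R, 0 < e -> exists N : nat, forall m n : nat,
             (N <= m)%N -> (N <= n)%N -> d (u m) (u n) < e) ->
         exists x : T, forall e : R, 0 < e -> exists N : nat, forall n : nat,
             (N <= n)%N -> d (u n) x < e)].

Lemma exists_natSinv_lt (R : realType) (e : R) : 0 < e -> exists N, N.+1%:R^-1 < e.
Proof.
move=> e0; have [N _ /(_ N (leqnn N)) /= h] := near_infty_natSinv_lt (PosNum e0).
by exists N.
Qed.

Lemma bigcup_ordE (T : Type) (F : nat -> set T) :
  \bigcup_n \bigcup_(k in `I_n) F k = \bigcup_k F k.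
Proof.
apply/seteqP; split=> [x [n _ [k _ Fk]]|x [k _ Fk]]; first by exists k.
by exists k.+1 => //; exists k => /=.
Qed.

Lemma bigcup_ord_homo (T : Type) (F : nat -> set T) :
  {homo (fun n => \bigcup_(k in `I_n) F k) : n m / (n <= m)%N >-> n `<=` m}.
Proof. by move=> n m nm x [k /= kn Fk]; exists k => //=; exact: leq_trans nm. Qed.

Lemma bigcup_ordS (T : Type) (F : nat -> set T) n :
  \bigcup_(k in `I_n.+1) F k = \bigcup_(k in `I_n) F k `|` F n.
Proof. by rewrite IIS bigcup_setU bigcup_set1. Qed.

Section small_unions.
Context (d : measure_display) (T : measurableType d) (R : realType) (P : probability T R).

(** The errors form a geometric series with sum [e]; for [e = 0] this says that a countable union of
    null sets is null. *)
Lemma prob_bigcup_geometric (D : nat -> set T) (e : R) :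
  (forall n, measurable (D n)) -> (forall n, prob P (D n) <= e * 2^-1 ^+ n.+1) ->
  prob P (\bigcup_n D n) <= e.
Proof.
move=> mD De; have mU n : measurable (\bigcup_(k in `I_n) D k).
  by apply: bigcup_measurable.
have e0 : 0 <= e.
  have := le_trans (prob_ge0 P (D 0%N)) (De 0%N); rewrite expr1; lra.
rewrite -bigcup_ordE; apply: prob_bigcup_le => //; first exact: bigcup_ord_homo.
suff h n : prob P (\bigcup_(k in `I_n) D k) <= e * (1 - 2^-1 ^+ n).
  move=> n; apply: le_trans (h n) _; rewrite ler_piMr// gerBl exprn_ge0//; lra.
elim: n => [|n IH]; first by rewrite II0 bigcup_set0 expr0 subrr mulr0 /prob measure0.
rewrite bigcup_ordS; apply: le_trans (prob_le_U _ (mU n) (mD n)) _.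
by have := De n; rewrite exprS; lra.
Qed.

End small_unions.

Section polish_space.
Context (R : realType) (S : ptopologicalType) (d : S -> S -> R).
Hypothesis cd : complete_metric d.

Definition mball (x : S) (e : R) : set S := [set y | d x y < e].

Lemma mdist_refl x : d x x = 0.
Proof. by have [h _ _ _ _] := cd; apply/h. Qed.

Lemma mdist_sym x y : d x y = d y x.
Proof. by have [_ h _ _ _] := cd. Qed.

Lemma mdist_triangle y x z : d x z <= d x y + d y z.
Proof. by have [_ _ h _ _] := cd. Qed.

Lemma open_mballP (A : set S) :
  open A <-> forall x, A x -> exists2 e : R, 0 < e & mball x e `<=` A.
Proof. by have [_ _ _ h _] := cd. Qed.

Lemma mball_center x e : 0 < e -> mball x e x.
Proof. by rewrite /mball/= mdist_refl. Qed.

Lemma open_mball x e : open (mball x e).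
Proof.
apply/open_mballP => y xy; exists (e - d x y); first by rewrite subr_gt0.
move=> z yz; have := mdist_triangle y x z; rewrite /mball/= in yz *; lra.
Qed.

Lemma nbhs_mballP x (A : set S) : nbhs x A <-> exists2 e : R, 0 < e & mball x e `<=` A.
Proof.
split=> [|[e e0 xA]].
  rewrite nbhsE => -[B [oB Bx] BA]; have [e e0 eB] := (open_mballP B).1 oB x Bx.
  by exists e => //; exact: subset_trans BA.
apply: filterS xA _; apply: open_nbhs_nbhs; split; [exact: open_mball|exact: mball_center].
Qed.

Lemma closed_mball x e : closed [set y | d x y <= e].
Proof.
rewrite -openC; apply/open_mballP => y /= /negP; rewrite -ltNge => xy.
exists (d x y - e); first by rewrite subr_gt0.
move=> z yz /=; apply/negP; rewrite -ltNge; have := mdist_triangle z x y.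
rewrite (mdist_sym z); rewrite /mball/= in yz; lra.
Qed.

Lemma closed_approx (C : set S) x :
  closed C -> (forall e, 0 < e -> exists2 y, C y & d x y < e) -> C x.
Proof.
move=> cC h; apply: contrapT => Cx.
have [e e0 eC] := (open_mballP (~` C)).1 (closed_openC cC) x Cx.
by have [y Cy xy] := h e e0; exact: (eC y).
Qed.

Lemma borel_open (A : set S) : open A -> measurable (A : set (borel S)).
Proof. exact: sub_sigma_algebra. Qed.

Lemma borel_closed (A : set S) : closed A -> measurable (A : set (borel S)).
Proof.
by move=> cA; rewrite -(setCK A); apply: measurableC; apply: borel_open; exact: closed_openC.
Qed.

(** * Regularity of Borel probabilities *)

Definition thickening (C : set S) (e : R) : set S := \bigcup_(x in C) mball x e.

Lemma open_thickening C e : open (thickening C e).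
Proof. by apply: bigcup_open => x _; exact: open_mball. Qed.

Lemma closed_thickeningE C : closed C -> \bigcap_n thickening C n.+1%:R^-1 = C.
Proof.
move=> cC; apply/seteqP; split=> [x Tx|x Cx n _].
  apply: closed_approx => // e e0; have [N Ne] := exists_natSinv_lt e0.
  have [y Cy yx] := Tx N I; exists y => //; rewrite mdist_sym.
  by apply: lt_trans Ne.
by exists x => //; exact: mball_center.
Qed.

Lemma closed_outer_open (mu : probability (borel S) R) C e :
  closed C -> 0 < e ->
  exists O, [/\ open O, C `<=` O & prob mu O < prob mu C + e].
Proof.
move=> cC e0; have [||n] := prob_bigcap_approx mu (F := fun n => thickening C n.+1%:R^-1) _ _ e0.
- by move=> n; apply: borel_open; exact: open_thickening.
- move=> n m nm x [y Cy xy]; exists y => //; apply: lt_le_trans xy _.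
  by rewrite lef_pV2 ?posrE// ler_nat.
rewrite closed_thickeningE// => h; exists (thickening C n.+1%:R^-1).
split => //; first exact: open_thickening.
by move=> x Cx; exists x => //; exact: mball_center.
Qed.

(** Asking for closed sets inside and open sets outside simultaneously makes the condition symmetric
    under complement, so that the regular sets form a sigma-algebra. *)
Definition regular_set (mu : probability (borel S) R) (B : set S) : Prop :=
  measurable (B : set (borel S)) /\
  forall e : R, 0 < e -> exists C O,
    [/\ closed C, open O, C `<=` B, B `<=` O & prob mu O < prob mu C + e].

Lemma regular_closed mu C : closed C -> regular_set mu C.
Proof.
move=> cC; split => [|e e0]; first exact: borel_closed.
have [U [oU CU Ue]] := closed_outer_open mu cC e0.
by exists C, U; split.
Qed.

Lemma regularC mu B : regular_set mu B -> regular_set mu (~` B).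
Proof.
move=> [mB h]; split => [|e e0]; first exact: measurableC.
have [C [U [cC oO CB BO Oe]]] := h e e0; exists (~` U), (~` C); split.
- exact: open_closedC.
- exact: closed_openC.
- exact: subsetC.
- exact: subsetC.
- rewrite (probC _ (borel_open oO)) (probC _ (borel_closed cC)); lra.
Qed.

(** The outer open sets can be united countably, the inner closed ones only finitely. Half of [e]
    therefore pays for the gaps between the two, and half for truncating the union of the closed
    sets. *)
Lemma regular_bigcup mu (B : nat -> set S) :
  (forall n, regular_set mu (B n)) -> regular_set mu (\bigcup_n B n).
Proof.
move=> rB; split => [|e e0].
  by apply: bigcupT_measurable => n; have [] := rB n.
have e20 : 0 < e / 2 by rewrite divr_gt0.
have hn n : exists CO : set S * set S, [/\ closed CO.1, open CO.2,
    CO.1 `<=` B n, B n `<=` CO.2 & prob mu CO.2 < prob mu CO.1 + e / 2 * 2^-1 ^+ n.+1].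
  have [_ /(_ (e / 2 * 2^-1 ^+ n.+1))[|C [U ?]]] := rB n; last by exists (C, U).
  by rewrite mulr_gt0// exprn_gt0.
have [CO hCO] := choice hn.
have mC n : measurable ((CO n).1 : set (borel S)).
  by have [? _ _ _ _] := hCO n; exact: borel_closed.
have mO n : measurable ((CO n).2 : set (borel S)).
  by have [_ ? _ _ _] := hCO n; exact: borel_open.
have mD n : measurable ((CO n).2 `\` (CO n).1 : set (borel S)) by exact: measurableD.
have small : prob mu (\bigcup_n ((CO n).2 `\` (CO n).1)) <= e / 2.
  apply: prob_bigcup_geometric => // n.
  have [_ _ CB BO] := hCO n; rewrite probD//; last exact: subset_trans BO.
  lra.
have mUC n : measurable (\bigcup_(k in `I_n) (CO k).1 : set (borel S)).
  exact: bigcup_measurable.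
have [n hn'] := prob_bigcup_approx mu mUC (@bigcup_ord_homo _ _) e20.
rewrite bigcup_ordE in hn'.
exists (\bigcup_(k in `I_n) (CO k).1), (\bigcup_k (CO k).2); split.
- by apply: closed_bigcup => [|k _]; [exact: finite_II|have [] := hCO k].
- by apply: bigcup_open => k _; have [] := hCO k.
- by move=> x [k _ Ck]; exists k => //; have [_ _ h _ _] := hCO k; exact: h.
- by move=> x [k _ Bk]; exists k => //; have [_ _ _ h _] := hCO k; exact: h.
- have mUC' : measurable (\bigcup_k (CO k).1 : set (borel S)) by exact: bigcupT_measurable.
  have mUD' : measurable (\bigcup_k ((CO k).2 `\` (CO k).1) : set (borel S)).
    exact: bigcupT_measurable.
  have mUO : measurable (\bigcup_k (CO k).2 : set (borel S)) by exact: bigcupT_measurable.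
  have sub : \bigcup_k (CO k).2 `<=` \bigcup_k (CO k).1 `|` \bigcup_k ((CO k).2 `\` (CO k).1).
    move=> x [k _ Ok]; have [Ck|Ck] := pselect ((CO k).1 x); first by left; exists k.
    by right; exists k.
  have := prob_le mu mUO (measurableU _ _ mUC' mUD') sub.
  have := prob_le_U mu mUC' mUD'; lra.
Qed.

Lemma borel_regular mu (B : set S) :
  measurable (B : set (borel S)) -> regular_set mu B.
Proof.
apply: smallest_sub B; last first.
  move=> A oA; rewrite -(setCK A); apply: regularC; apply: regular_closed.
  exact: open_closedC.
split.
- by apply: regular_closed; exact: closed0.
- by move=> A rA; rewrite setTD; exact: regularC.
- exact: regular_bigcup.
Qed.

(** * Dense sequences and tightness *)

Lemma dense_sequence : separable_space S ->
  exists q : nat -> S, forall x e, 0 < e -> exists n, mball (q n) e x.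
Proof.
move=> [D [/countable_injP[f finj] dD]].
(* This inverts the injection [f] on [D]; indices outside the range of [f] receive the default
   [point], which is harmless because only the existence of a close term is claimed. *)
exists (fun n => xget point [set x | D x /\ f x = n]) => x e e0.
have [|y [xy Dy]] := dD (mball x e) _ (open_mball x e).
  by exists x; exact: mball_center.
exists (f y); have [|Dz fz] := @xgetPex S point [set z | D z /\ f z = f y].
  by exists y.
by rewrite /mball/= (finj _ _ _ _ fz) ?inE// mdist_sym.
Qed.

Section dense.
Variable q : nat -> S.
Hypothesis qd : forall x e, 0 < e -> exists n, mball (q n) e x.

(** The bound is stated for all large [n], so that one [n] can serve two measures. *)
Lemma mball_cover (mu : probability (borel S) R) (delta e : R) :
  0 < delta -> 0 < e ->
  exists N, forall n, (N <= n)%N ->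
    prob mu (~` \bigcup_(k in `I_n) mball (q k) delta) < e.
Proof.
move=> delta0 e0; have mU n : measurable (\bigcup_(k in `I_n) mball (q k) delta : set (borel S)).
  by apply: bigcup_measurable => k _; apply: borel_open; exact: open_mball.
have [N] := prob_bigcup_approx mu mU (@bigcup_ord_homo _ _) e0.
rewrite bigcup_ordE (_ : \bigcup_k _ = setT); last first.
  by rewrite -subTset => x _; have [n qx] := qd x delta0; exists n.
move=> hN; exists N => n Nn; rewrite (probC _ (mU n)); rewrite probT in hN.
have := prob_le mu (mU N) (mU n) (bigcup_ord_homo Nn); lra.
Qed.

Lemma ultra_bigcup_ord (T : Type) (F : set_system T) (B : nat -> set T) n :
  UltraFilter F -> F (\bigcup_(k in `I_n) B k) -> exists2 k, (k < n)%N & F (B k).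
Proof.
move=> UF; elim: n => [|n IH]; first by rewrite II0 bigcup_set0 => /filter_not_empty.
rewrite bigcup_ordS => FU; have [FB|FB] := in_ultra_setVsetC (B n) UF.
  by exists n.
have [|k kn FBk] := IH; last by exists k => //; exact: ltnW.
by apply: filterS (filterI FU FB) => x [[|Bx] nBx].
Qed.

(** An ultrafilter on this set contains, for each [m], one of the finitely many balls of radius
    [1 / (m + 1)]. Members of a filter meet, so the chosen centres form a Cauchy sequence, and the
    ultrafilter converges to its limit. *)
Lemma totally_bounded_compact (N : nat -> nat) :
  compact (\bigcap_m \bigcup_(k in `I_(N m)) [set y | d (q k) y <= m.+1%:R^-1]).
Proof.
set K := bigcap _ _; have cK : closed K.
  apply: closed_bigI => m _; apply: closed_bigcup => [|k _]; first exact: finite_II.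
  exact: closed_mball.
rewrite compact_ultra => F UF FK.
have hk m : exists k, F [set y | d (q k) y <= m.+1%:R^-1].
  have [|k _ Fk] := @ultra_bigcup_ord _ _ (fun k => [set y | d (q k) y <= m.+1%:R^-1]) (N m) UF.
    by apply: filterS FK => y /(_ m I).
  by exists k.
have [k Fk] := choice hk.
have dk m n : d (q (k m)) (q (k n)) <= m.+1%:R^-1 + n.+1%:R^-1.
  have [y [my ny]] := filter_ex (filterI (Fk m) (Fk n)).
  by apply: le_trans (mdist_triangle y _ _) _; rewrite (mdist_sym y) lerD.
have [_ _ _ _ cpl] := cd.
have [e e0|x qx] := cpl (fun m => q (k m)).
  have [M Me] : exists M, M.+1%:R^-1 < e / 2 by apply: exists_natSinv_lt; rewrite divr_gt0.
  have inv_le j : (M <= j)%N -> j.+1%:R^-1 <= M.+1%:R^-1 :> R.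
    by move=> Mj; rewrite lef_pV2 ?posrE// ler_nat.
  exists M => m n /inv_le mM /inv_le nM; apply: le_lt_trans (dk m n) _.
  by rewrite [e]splitr; apply: ltrD; apply: le_lt_trans Me.
have Fx : F --> x.
  move=> A /nbhs_mballP[e e0 eA].
  have [|N1 hN1] := qx (e / 2); first by rewrite divr_gt0.
  have [|M Me] := @exists_natSinv_lt R (e / 2); first by rewrite divr_gt0.
  apply: filterS (Fk (maxn N1 M)) => y /= qy; apply: eA.
  rewrite /mball/=; have := mdist_triangle (q (k (maxn N1 M))) x y.
  have := hN1 _ (leq_maxl N1 M); rewrite mdist_sym.
  have : (maxn N1 M).+1%:R^-1 <= M.+1%:R^-1 :> R.
    by rewrite lef_pV2 ?posrE// ler_nat ltnS leq_maxr.
  by move: (_^-1) (_^-1) qy Me => u v; lra.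
exists x; split => //; exact: (closed_cvg K cK (FF := ultra_proper) (u_ := id)) Fx.
Qed.

(** Ulam's theorem: at the [m]-th scale all but [e / 2 ^ (m + 1)] of the mass lies in finitely many
    balls, and the intersection over all scales of these unions, with the balls taken closed, is
    compact. *)
Lemma tight (mu : probability (borel S) R) (e : R) : 0 < e ->
  exists K, [/\ compact K, closed K & prob mu (~` K) <= e].
Proof.
move=> e0; have hN m : exists N,
    prob mu (~` \bigcup_(k in `I_N) mball (q k) m.+1%:R^-1) < e * 2^-1 ^+ m.+1.
  have [||N] := mball_cover mu (delta := m.+1%:R^-1) (e := e * 2^-1 ^+ m.+1) => //.
    by rewrite mulr_gt0// exprn_gt0.
  by move=> /(_ N (leqnn N)); exists N.
have [N Ne] := choice hN.
exists (\bigcap_m \bigcup_(k in `I_(N m)) [set y | d (q k) y <= m.+1%:R^-1]).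
have cK m : closed (\bigcup_(k in `I_(N m)) [set y | d (q k) y <= m.+1%:R^-1]).
  by apply: closed_bigcup => [|k _]; [exact: finite_II|exact: closed_mball].
split; first exact: totally_bounded_compact.
  by apply: closed_bigI => m _; exact: cK.
rewrite setC_bigcap; apply: prob_bigcup_geometric => m.
  by apply: measurableC; exact: borel_closed.
apply: le_trans (ltW (Ne m)); apply: prob_le.
- by apply: measurableC; exact: borel_closed.
- apply: measurableC; apply: borel_open; apply: bigcup_open => k _; exact: open_mball.
- by apply: subsetC => y [k kN qy]; exists k => //; exact: ltW.
Qed.

Lemma compact_inner_regular (mu : probability (borel S) R) (B : set S) (e : R) :
  measurable (B : set (borel S)) -> 0 < e ->
  exists K, [/\ compact K, closed K, K `<=` B & prob mu B - e < prob mu K].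
Proof.
move=> mB e0; have e20 : 0 < e / 2 by rewrite divr_gt0.
have [_ /(_ _ e20)[C [U [cC oO CB BO Oe]]]] := borel_regular mu mB.
have [K [compK cK Ke]] := tight mu e20.
exists (K `&` C); split.
- exact: compact_closedI.
- exact: closedI.
- by move=> x [_ /CB].
have mK := borel_closed cK; have mC := borel_closed cC.
have := probUI mu mK mC; have := prob_le mu mB (borel_open oO) BO.
have := prob_le1 mu (measurableU _ _ mK mC); rewrite probC// in Ke; lra.
Qed.

End dense.

(** * Closed relations in the product space *)

Lemma nbhs_pprodP (z : pprod S) (A : set (pprod S)) :
  nbhs z A <-> exists2 e : R, 0 < e & mball z.1 e `*` mball z.2 e `<=` A.
Proof.
split=> [[[P Q] /= [/nbhs_mballP[e e0 eP] /nbhs_mballP[f f0 fQ]] PQA]|[e e0 eA]].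
  exists (Num.min e f); first by rewrite lt_min e0.
  move=> -[x y] [/= zx zy]; apply: PQA; split; [apply: eP|apply: fQ].
    by apply: lt_le_trans zx _; rewrite ge_min lexx.
  by apply: lt_le_trans zy _; rewrite ge_min lexx orbT.
exists (mball z.1 e, mball z.2 e) => //=.
by split; apply/nbhs_mballP; exists e.
Qed.

Lemma closed_pprod_approx (F : set (pprod S)) x y : closed F ->
  (forall e, 0 < e -> exists x' y', [/\ F (x', y'), d x x' < e & d y y' < e]) -> F (x, y).
Proof.
move=> cF h; apply: cF => A /nbhs_pprodP[e e0 eA].
by have [x' [y' [Fxy xx yy]]] := h e e0; exists (x', y'); split => //; exact: eA.
Qed.

(** For [y] in the closure, the points of [K] related to something within [e] of [y] form a filter
    base as [e] varies. Compactness yields a cluster point [x], and closedness of [F] puts [(x, y)]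
    in [F]. *)
Lemma closed_rel_image (F : set (pprod S)) (K : set S) :
  closed F -> compact K -> closed [set y | exists2 x, K x & F (x, y)].
Proof.
move=> cF cK y /= ycl.
pose B e := [set x | K x /\ exists2 y', d y y' < e & F (x, y')].
have BF : ProperFilter (filter_from [set e : R | 0 < e] B).
  apply: filter_from_proper => [|e e0].
    apply: filter_from_filter => [|e f /= e0 f0]; first by exists 1 => /=.
    exists (Num.min e f) => /=; first by rewrite lt_min e0.
    move=> x [Kx [y']]; rewrite lt_min => /andP[ye yf] Fxy.
    by split; split => //; exists y'.
  have [|y' [[x Kx Fxy] yy']] := ycl (mball y e); first by apply/nbhs_mballP; exists e.
  by exists x; split => //; exists y'.
have [|x [Kx xcl]] := cK _ BF; first by exists 1 => //= x [].
exists x => //; apply: closed_pprod_approx => // e e0.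
have [||x' [[_ [y' yy' Fxy]] xx']] := xcl (B e) (mball x e).
- by exists e.
- by apply/nbhs_mballP; exists e.
by exists x', y'.
Qed.

End polish_space.

(** * From finitely additive couplings to measures *)

Lemma measurable_fun_borel (d : measure_display) (T : measurableType d)
    (Q : ptopologicalType) (f : T -> borel Q) :
  (forall G : set Q, open G -> measurable (f @^-1` G)) -> measurable_fun setT f.
Proof.
move=> h; apply: (@measurability _ _ T (borel Q) setT f (@open Q)) => // _ [G oG <-].
by rewrite setTI; exact: h.
Qed.

Section pushforward_probability.
Context (d1 d2 : measure_display) (T1 : measurableType d1) (T2 : measurableType d2).
Context (R : realType) (m : {measure set T1 -> \bar R}) (f : T1 -> T2).
Hypothesis mf : measurable_fun [set: T1] f.
Hypothesis m1 : m setT = 1%E.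

Definition image_probability : set T2 -> \bar R := fun A => m (f @^-1` A).

Let image0 : image_probability set0 = 0%E.
Proof. by rewrite /image_probability preimage_set0 measure0. Qed.

Let image_ge0 A : (0 <= image_probability A)%E.
Proof. exact: measure_ge0. Qed.

Let image_sigma_additive : semi_sigma_additive image_probability.
Proof. exact: (@measure_semi_sigma_additive _ _ _ (pushforward m f)). Qed.

HB.instance Definition _ := isMeasure.Build _ _ _ image_probability
  image0 image_ge0 image_sigma_additive.

Let image_setT : image_probability setT = 1%E.
Proof. by rewrite /image_probability preimage_setT. Qed.

HB.instance Definition _ :=
  Measure_isProbability.Build _ _ _ image_probability image_setT.

Lemma pushforward_probability :
  exists Q : probability T2 R, forall A, Q A = m (f @^-1` A).
Proof. by exists image_probability. Qed.

End pushforward_probability.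

(** * The semiring of measurable rectangles *)

Section rectangle_semiring.
Context (d1 d2 : measure_display) (T1 : measurableType d1) (T2 : measurableType d2).

(** An alias of the product, so that it can carry the semiring of rectangles in place of the product
    sigma-algebra. *)
Definition rectangle_type : Type := (T1 * T2)%type.

HB.instance Definition _ := Pointed.on rectangle_type.

Definition rectangle : set (set rectangle_type) :=
  [set X | exists A B, [/\ measurable A, measurable B & X = A `*` B]].

Let rectangle0 : rectangle set0.
Proof. by exists set0, set0; split => //; rewrite setX0. Qed.

Let rectangleI : setI_closed rectangle.
Proof.
move=> _ _ [A [B [mA mB ->]]] [A' [B' [mA' mB' ->]]].
by exists (A `&` A'), (B `&` B'); split; rewrite ?setXI//; exact: measurableI.
Qed.

Lemma setXD (A A' : set T1) (B B' : set T2) :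
  A `*` B `\` A' `*` B' = (A `\` A') `*` B `|` (A `&` A') `*` (B `\` B').
Proof.
apply/seteqP; split=> [[x y] [[/= Ax By] h]|[x y] [[[/= Ax A'x] By]|[[/= Ax A'x] [By B'y]]]].
- have [A'x|A'x] := pselect (A' x); last by left.
  by right; split => //; split => // B'y; exact: h.
- by split => // -[].
- by split => // -[].
Qed.

Let rectangleD : semi_setD_closed rectangle.
Proof.
move=> _ _ [A [B [mA mB ->]]] [A' [B' [mA' mB' ->]]].
exists [set (A `\` A') `*` B; (A `&` A') `*` (B `\` B')]; split.
- exact: finite_set2.
- move=> X [->|->].
    by exists (A `\` A'), B; split => //; exact: measurableD.
  by exists (A `&` A'), (B `\` B'); split => //; [exact: measurableI|exact: measurableD].
- by rewrite bigcup_setU !bigcup_set1 setXD.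
- move=> X Y /= [->|->] [->|->] //= [[x y]] [[[/= Ax A'x] By] [[/= A2 A3] B2]] //.
Qed.

(** Ending in [Qed] makes the result an opaque tag, which unification does not confuse with the
    display of the first factor. *)
Definition rectangle_display : measure_display -> measure_display -> measure_display.
Proof. by move=> a _; exact: a. Qed.

HB.instance Definition _ := @isSemiRingOfSets.Build (rectangle_display d1 d2)
  rectangle_type rectangle rectangle0 rectangleI rectangleD.

End rectangle_semiring.

(** * Open sets as countable unions of rectangles *)

Section second_countable.
Context (R : realType) (S : ptopologicalType) (d : S -> S -> R).
Hypothesis cd : complete_metric d.
Variable q : nat -> S.
Hypothesis qd : forall x e, 0 < e -> exists n, mball d (q n) e x.

(** Each rectangle is kept at a margin [r k] from the complement of [G]. The margin is what later
    allows a discrete coupling of mesh below [r k] to detect that the rectangle avoids a closed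
    relation. *)
Lemma open_pprod_bigcup (G : set (pprod S)) : open G ->
  exists (U V : nat -> set S) (r : nat -> R),
    [/\ forall k, open (U k) /\ open (V k), forall k, 0 < r k,
        forall k x y x' y', U k x -> V k y -> d x x' < r k -> d y y' < r k -> G (x', y') &
        G = \bigcup_k (U k `*` V k)].
Proof.
move=> oG.
(* A triple codes two centres and a radius [1 / (n + 1)]. It is accepted when the rectangle of
   doubled radius lies in [G], which leaves one radius as margin; other indices give the empty
   set. *)
pose wide (t : nat * nat * nat) := forall x' y', d (q t.1.1) x' < 2 * t.2.+1%:R^-1 ->
  d (q t.1.2) y' < 2 * t.2.+1%:R^-1 -> G (x', y').
pose W (i : nat * nat * nat -> nat) k : set S :=
  if (unpickle k : option (nat * nat * nat)) is Some t then
    if `[< wide t >] then mball d (q (i t)) t.2.+1%:R^-1 else set0 else set0.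
pose r k : R :=
  if (unpickle k : option (nat * nat * nat)) is Some t then t.2.+1%:R^-1 else 1.
have oW i k : open (W i k).
  rewrite /W; case: unpickle => [t|]; last exact: open0.
  by case: ifP => _; [exact: open_mball|exact: open0].
have sep k x y x' y' : W (fun t => t.1.1) k x -> W (fun t => t.1.2) k y ->
    d x x' < r k -> d y y' < r k -> G (x', y').
  rewrite /W /r; case: unpickle => [t|//]; case: asboolP => // wt.
  rewrite /mball/= => qx qy xx yy; apply: wt; rewrite mulrDl mul1r.
    by apply: le_lt_trans (mdist_triangle cd x _ _) _; rewrite ltrD.
  by apply: le_lt_trans (mdist_triangle cd y _ _) _; rewrite ltrD.
exists (W (fun t => t.1.1)), (W (fun t => t.1.2)), r; split => //.
  by move=> k; rewrite /r; case: unpickle.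
apply/seteqP; split=> [[x y] Gxy|[x y] [k _ [/= Ux Vy]]]; last first.
  apply: sep Ux Vy _ _; rewrite ?(mdist_refl cd) /r; by case: unpickle.
have [e e0 eG] := (nbhs_pprodP cd _ _).1 (open_nbhs_nbhs (conj oG Gxy)).
(* A point within two radii of a centre is within three radii of [x], hence the division by 3. *)
have [|n ne] := @exists_natSinv_lt R (e / 3); first by rewrite divr_gt0.
have [|i qi] := qd x (e := n.+1%:R^-1); first by [].
have [|j qj] := qd y (e := n.+1%:R^-1); first by [].
exists (pickle (i, j, n)) => //.
have wt : wide (i, j, n).
  move=> x' y' /= ix jy; apply: eG; split; rewrite /mball/=.
    have := mdist_triangle cd (q i) x x'; rewrite (mdist_sym cd x (q i)).
    by move: qi ix ne; rewrite /mball/=; move: (n.+1%:R^-1) => s; lra.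
  have := mdist_triangle cd (q j) y y'; rewrite (mdist_sym cd y (q j)).
  by move: qj jy ne; rewrite /mball/=; move: (n.+1%:R^-1) => s; lra.
by rewrite /W pickleK; case: asboolP.
Qed.

End second_countable.

(** * Extending an additive function whose marginals are measures *)

Section bimeasure_extension.
Context (R : realType) (S : ptopologicalType) (d : S -> S -> R).
Hypothesis cd : complete_metric d.
Variable q : nat -> S.
Hypothesis qd : forall x e, 0 < e -> exists n, mball d (q n) e x.
Variables mu nu : probability (borel S) R.
Variable lam : set (borel S * borel S) -> R.
Hypothesis lam_ge0 : forall X, 0 <= lam X.
Hypothesis lamU : forall X Y, measurable X -> measurable Y -> X `&` Y = set0 ->
  lam (X `|` Y) = lam X + lam Y.
Hypothesis lam1 : forall A : set (borel S), measurable A ->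
  lam (A `*` setT) = prob mu A.
Hypothesis lam2 : forall A : set (borel S), measurable A ->
  lam (setT `*` A) = prob nu A.

Lemma lam_le X Y : measurable X -> measurable Y -> X `<=` Y -> lam X <= lam Y.
Proof.
move=> mX mY XY; rewrite -(setDUK XY) lamU ?lerDl//; first exact: measurableD.
by rewrite setDE setIC -setIA setICl setI0.
Qed.

Lemma lam_le_U X Y : measurable X -> measurable Y -> lam (X `|` Y) <= lam X + lam Y.
Proof.
move=> mX mY; have mYX : measurable (Y `\` X) by exact: measurableD.
have -> : X `|` Y = X `|` (Y `\` X).
  apply/seteqP; split=> [z [Xz|Yz]|z [Xz|[Yz _]]]; [by left| |by left|by right].
  by have [Xz|Xz] := pselect (X z); [left|right].
rewrite lamU//; first by rewrite lerD2l lam_le// => z [].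
by apply/seteqP; split=> [z [Xz [_ /(_ Xz)]]|].
Qed.

Lemma lam0 : lam set0 = 0.
Proof.
by have := @lamU set0 set0 measurable0 measurable0 (setI0 _); rewrite setU0; lra.
Qed.

Lemma lam_le_bigcup (X : nat -> set (borel S * borel S)) n :
  (forall k, measurable (X k)) -> lam (\bigcup_(k in `I_n) X k) <= \sum_(k < n) lam (X k).
Proof.
move=> mX; elim: n => [|n IH]; first by rewrite II0 bigcup_set0 big_ord0 lam0.
rewrite bigcup_ordS big_ord_recr/=; apply: le_trans (lam_le_U _ (mX n)) _.
  exact: bigcup_measurable.
by rewrite lerD2r.
Qed.

Let rect : semiRingOfSetsType _ := rectangle_type (borel S) (borel S).

Definition premeasure : set rect -> \bar R := fun X => (lam X)%:E.

Lemma rectangle_measurable (X : set rect) :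
  measurable X -> measurable (X : set (borel S * borel S)).
Proof. by move=> [A [B [mA mB ->]]]; exact: measurableX. Qed.

Let premeasure_ge0 X : (0 <= premeasure X)%E.
Proof. by rewrite lee_fin. Qed.

Let premeasure_additive : measure_function.semi_additive premeasure.
Proof.
move=> F n mF tF _; rewrite /premeasure sumEFin; congr _%:E.
elim: n => [|n IH]; first by rewrite !big_ord0 lam0.
rewrite !big_ord_recr/= lamU ?IH//.
- by apply: bigsetU_measurable => k _; exact: rectangle_measurable.
- exact: rectangle_measurable.
- rewrite -bigcup_mkord setI_bigcupl bigcup0// => k /= kn.
  by move/trivIsetP : tF; apply => //; rewrite ltn_eqF.
Qed.

HB.instance Definition _ :=
  isContent.Build _ _ _ premeasure premeasure_ge0 premeasure_additive.

(** The difference of the two rectangles is covered by a vertical and a horizontal strip, whose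
    masses are given by the marginals. Regularity of [mu] and [nu] thus passes to rectangles. *)
Lemma lam_setX_outer (A B A' B' : set (borel S)) :
  measurable A -> measurable B -> measurable A' -> measurable B' ->
  A `<=` A' -> B `<=` B' ->
  lam (A' `*` B') <= lam (A `*` B) + (prob mu A' - prob mu A) + (prob nu B' - prob nu B).
Proof.
move=> mA mB mA' mB' AA BB; rewrite -(probD _ mA' mA)// -(probD _ mB' mB)//.
have mAD := measurableD mA' mA; have mBD := measurableD mB' mB.
rewrite -lam1// -lam2//.
have m1 : measurable ((A' `\` A) `*` setT : set (borel S * borel S)) by exact: measurableX.
have m2 : measurable (setT `*` (B' `\` B) : set (borel S * borel S)) by exact: measurableX.
have m3 : measurable (A `*` B : set (borel S * borel S)) by exact: measurableX.
apply: (@le_trans _ _ (lam ((A `*` B `|` (A' `\` A) `*` setT) `|` setT `*` (B' `\` B)))).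
  apply: lam_le; [exact: measurableX|by apply: measurableU => //; exact: measurableU|].
  move=> [x y] [/= Ax By]; have [Ax'|Ax'] := pselect (A x); last by left; right.
  by have [By'|By'] := pselect (B y); [left; left|right].
apply: (le_trans (lam_le_U _ _)) => //; first exact: measurableU.
by rewrite lerD2r; exact: lam_le_U.
Qed.

(* Alexandroff's argument: shrink the rectangle to a compact one, enlarge the
   covering rectangles to open ones, and extract a finite subcover. *)
Let premeasure_sigma_subadditive : measurable_subset_sigma_subadditive premeasure.
Proof.
move=> X F mF [A [B [mA mB XE]]] XF; rewrite {X}XE in XF *.
have hF n : exists C : set (borel S) * set (borel S),
    [/\ measurable C.1, measurable C.2 & F n = C.1 `*` C.2].
  by have [C1 [C2 h]] := mF n; exists (C1, C2).
have [C hC] := choice hF.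
have mC1 n : measurable (C n).1 by have [] := hC n.
have mC2 n : measurable (C n).2 by have [] := hC n.
apply/lee_addgt0Pr => e e0.
(* Each of the two compact factors costs [e / 4], and the two open factors of the [n]-th covering
   rectangle cost [e / 2 * 2^-1 ^+ n.+1] together, in all at most [e]. *)
have e40 : 0 < e / 4 by rewrite divr_gt0.
have g0 n : 0 < e / 4 * 2^-1 ^+ n.+1 by rewrite mulr_gt0// exprn_gt0.
have outer (m : probability (borel S) R) (D : set (borel S)) n : measurable D ->
    exists U : set S, [/\ open U, D `<=` U & prob m U <= prob m D + e / 4 * 2^-1 ^+ n.+1].
  move=> mD; have [_ /(_ _ (g0 n))[K [U [cK oU KD DU UK]]]] := borel_regular cd m mD.
  exists U; split => //; have := prob_le m (borel_closed cK) mD KD; lra.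
have [U hU] := choice (fun n => outer mu (C n).1 n (mC1 n)).
have [V hV] := choice (fun n => outer nu (C n).2 n (mC2 n)).
have [K1 [K1c cK1 K1A K1e]] := compact_inner_regular cd qd mu mA e40.
have [K2 [K2c cK2 K2B K2e]] := compact_inner_regular cd qd nu mB e40.
have mU n : measurable (U n : set (borel S)) by have [? _ _] := hU n; exact: borel_open.
have mV n : measurable (V n : set (borel S)) by have [? _ _] := hV n; exact: borel_open.
have mK1 := borel_closed cK1; have mK2 := borel_closed cK2.
have oUV n : open (U n `*` V n : set (S * S)%type).
  rewrite openE => -[x y] [/= Ux Vy]; exists (U n, V n) => //=.
  by split; apply: open_nbhs_nbhs; split => //; [have [] := hU n|have [] := hV n].
have [N KN] : exists N, K1 `*` K2 `<=` \bigcup_(n in `I_N) (U n `*` V n).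
  have : cover_compact (K1 `*` K2 : set (pprod S)).
    by rewrite -compact_cover; exact: compact_setX.
  move=> /(_ nat setT (fun n => U n `*` V n)) [|z [Kz1 Kz2]|D' _ hD'].
  - by move=> n _; exact: oUV.
  - have [|n _] := XF z; first by split; [exact: K1A|exact: K2B].
    have [_ _ ->] := hC n => -[Cz1 Cz2]; exists n => //.
    by split; [have [_ h _] := hU n|have [_ h _] := hV n]; exact: h.
  exists (\max_(n <- finmap.enum_fset D') n).+1 => z /hD' [n /= nD' zn]; exists n => //=.
  by rewrite ltnS; exact: (@leq_bigmax_seq _ (finmap.enum_fset D') predT id).
have main : lam (A `*` B) <= \sum_(n < N) lam (F n) + e.
  have := lam_setX_outer mK1 mK2 mA mB K1A K2B.
  have : lam (K1 `*` K2) <= \sum_(n < N) lam (U n `*` V n).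
    have mUV n : measurable (U n `*` V n : set (borel S * borel S)) by exact: measurableX.
    apply: le_trans (lam_le_bigcup N mUV); apply: lam_le => //; first exact: measurableX.
    exact: bigcup_measurable.
  have : \sum_(n < N) lam (U n `*` V n) <=
      \sum_(n < N) (lam (F n) + e / 2 * 2^-1 ^+ n.+1).
    apply: ler_sum => n _; have [_ _ ->] := hC n.
    have [_ CU Ue] := hU n; have [_ CV Ve] := hV n.
    have := lam_setX_outer (mC1 n) (mC2 n) (mU n) (mV n) CU CV; lra.
  rewrite big_split/= -mulr_sumr.
  have : \sum_(n < N) (2^-1 : R) ^+ n.+1 <= 1.
    suff -> : \sum_(n < N) (2^-1 : R) ^+ n.+1 = 1 - 2^-1 ^+ N.
      by rewrite gerBl exprn_ge0.
    elim: (N) => [|k IH]; first by rewrite big_ord0 expr0 subrr.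
    by rewrite big_ord_recr/= IH exprS; lra.
  move: (\sum_(n < N) (2^-1) ^+ n.+1) (\sum_(n < N) lam (F n)) (\sum_(n < N) lam _) => s t u; nra.
apply: (@le_trans _ _ (\sum_(n < N) lam (F n) + e)%:E); first by rewrite lee_fin.
rewrite EFinD leeD2r// -sumEFin -(big_mkord xpredT (fun n => premeasure (F n))).
by apply: nneseries_lim_ge => n _ _; exact: premeasure_ge0.
Qed.

HB.instance Definition _ := Content_SigmaSubAdditive_isMeasure.Build _ _ _
  premeasure premeasure_sigma_subadditive.

Let ext : {measure set (g_sigma_algebraType (@measurable _ rect)) -> \bar R} :=
  measure_extension premeasure.

Let extE (A B : set (borel S)) : measurable A -> measurable B ->
  ext (A `*` B) = (lam (A `*` B))%:E.
Proof.
by move=> mA mB; rewrite /ext/= /measure_extension measurable_mu_extE//; exists A, B.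
Qed.

(** Caratheodory's extension lives on the sigma-algebra generated by rectangles; it contains the
    open sets of the product, so the identity transports the measure to [borel (pprod S)]. Agreement
    with [lam] is asserted on rectangles only, as [lam] need not be countably additive elsewhere. *)
Lemma bimeasure_extension : exists pi : probability (borel (pprod S)) R,
  forall A B : set (borel S), measurable A -> measurable B ->
    pi (A `*` B) = (lam (A `*` B))%:E.
Proof.
have mid : measurable_fun setT
    (id : g_sigma_algebraType (@measurable _ rect) -> borel (pprod S)).
  apply: measurable_fun_borel => G oG; rewrite preimage_id.
  have [U [V [r [oUV _ _ ->]]]] := open_pprod_bigcup cd qd oG.
  apply: bigcupT_measurable => k; apply: sub_sigma_algebra.
  by have [oU oV] := oUV k; exists (U k), (V k); split => //; exact: borel_open.
have ext1 : ext setT = 1%E by rewrite -setXTT extE// lam1// probT.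
have [pi hpi] := pushforward_probability mid ext1.
by exists pi => A B mA mB; rewrite hpi preimage_id extE.
Qed.

End bimeasure_extension.

(** * Couplings for a closed relation *)

Lemma open_setX (S : ptopologicalType) (U V : set S) :
  open U -> open V -> open (U `*` V : set (pprod S)).
Proof.
move=> oU oV; rewrite openE => -[x y] [/= Ux Vy]; exists (U, V) => //=.
by split; exact: open_nbhs_nbhs.
Qed.

Lemma borel_setX (S : ptopologicalType) (A B : set S) :
  measurable (A : set (borel S)) -> measurable (B : set (borel S)) ->
  measurable (A `*` B : set (borel (pprod S))).
Proof.
move=> mA mB.
have m1 : measurable_fun setT (fst : borel (pprod S) -> borel S).
  apply: measurable_fun_borel => G oG; apply: borel_open.
  by rewrite -[X in open X]setIT; apply: (open_setX oG openT).
have m2 : measurable_fun setT (snd : borel (pprod S) -> borel S).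
  apply: measurable_fun_borel => G oG; apply: borel_open.
  by rewrite -[X in open X]setTI; apply: (open_setX openT oG).
have := measurableI _ _ (m1 measurableT _ mA) (m2 measurableT _ mB).
by rewrite !setTI.
Qed.

(** * Masses of the cells of a finite partition *)

Section finite_partition.
Context (d : measure_display) (T : measurableType d) (R : realType) (P : probability T R).
Context (I : finType) (C : I -> set T).
Hypothesis mC : forall i, measurable (C i).
Hypothesis C_disj : forall i j x, C i x -> C j x -> i = j.
Hypothesis C_cover : forall x, exists i, C i x.

Lemma prob_partition (X : set T) : measurable X ->
  prob P X = \sum_i prob P (X `&` C i).
Proof.
move=> mX; pose U (s : seq I) : set T := [set x | exists2 i, i \in s & C i x].
have Ucons i s : U (i :: s) = C i `|` U s.
  apply/seteqP; split=> [x [j]|x [Cx|[j js Cjx]]].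
  - by rewrite inE => /predU1P[->|js] Cx; [left|right; exists j].
  - by exists i => //; rewrite inE eqxx.
  - by exists j => //; rewrite inE js orbT.
have U0 : U [::] = set0 by apply/seteqP; split=> [x []|].
have mU s : measurable (U s).
  by elim: s => [|i s IH]; [rewrite U0|rewrite Ucons; exact: measurableU].
have main s : uniq s -> prob P (X `&` U s) = \sum_(i <- s) prob P (X `&` C i).
  elim: s => [|i s IH] /=; first by rewrite U0 setI0 big_nil /prob measure0.
  move=> /andP[is_ us]; rewrite Ucons setIUr big_cons probU ?IH//.
  - exact: measurableI.
  - exact: measurableI.
  - apply/seteqP; split=> [x [[_ Cix] [_ [j js Cjx]]]|//].
    by rewrite (C_disj Cix Cjx) js in is_.
rewrite -main ?index_enum_uniq//; congr (prob P _); apply/seteqP; split=> [x Xx|x []//].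
by split => //; have [i Cx] := C_cover x; exists i => //; rewrite mem_index_enum.
Qed.

Lemma prob_partition_union (A : {set I}) :
  let U := [set x | exists2 i, i \in A & C i x] in
  measurable U /\ prob P U = \sum_(i in A) prob P (C i).
Proof.
move=> U; have mU : measurable U.
  rewrite (_ : U = \bigcup_(i in [set` A]) C i); first exact: fin_bigcup_measurable.
  by apply/seteqP; split=> [x [i iA Cx]|x [i iA Cx]]; exists i.
split => //; rewrite prob_partition// [RHS]big_mkcond/=; apply: eq_bigr => i _.
case: ifPn => iA; congr (prob P _) || rewrite (_ : _ `&` _ = set0) ?/prob ?measure0//.
  by apply/seteqP; split=> [x []//|x Cx]; split => //; exists i.
by apply/seteqP; split=> [x [[j jA Cj] Ci]|//]; rewrite (C_disj Ci Cj) jA in iA.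
Qed.

End finite_partition.

Section strassen.
Context (R : realType) (S : ptopologicalType) (d : S -> S -> R).
Hypothesis cd : complete_metric d.
Variable q : nat -> S.
Hypothesis qd : forall x e, 0 < e -> exists n, mball d (q n) e x.
Variables mu nu : probability (borel S) R.

(** Finitely many balls of radius [delta / 2] are made disjoint. The last cell is what they leave
    uncovered: its diameter is not controlled, but both measures give it little mass. *)
Lemma small_partition (delta : R) : 0 < delta ->
  exists n (C : 'I_n.+1 -> set S),
  [/\ forall i, measurable (C i : set (borel S)),
      forall i j x, C i x -> C j x -> i = j, forall x, exists i, C i x,
      forall i x y, i != ord_max -> C i x -> C i y -> d x y < delta &
      prob mu (C ord_max) < delta /\ prob nu (C ord_max) < delta].
Proof.
move=> delta0; have d20 : 0 < delta / 2 by rewrite divr_gt0.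
have [N1 h1] := mball_cover cd qd mu d20 delta0.
have [N2 h2] := mball_cover cd qd nu d20 delta0.
pose n := maxn N1 N2; pose B k := mball d (q k) (delta / 2).
have mB k : measurable (B k : set (borel S)) by apply: borel_open; exact: open_mball.
have mU k : measurable (\bigcup_(j in `I_k) B j : set (borel S)) by exact: bigcup_measurable.
pose C (i : 'I_n.+1) : set S :=
  (if (i < n)%N then B i else setT) `\` \bigcup_(j in `I_i) B j.
exists n, C; split.
- by move=> i; rewrite /C; apply: measurableD => //; case: ifP.
- have lt (i j : 'I_n.+1) x : (i < j)%N -> C i x -> C j x -> False.
    move=> ij [+ _] [_]; have -> : (i < n)%N by exact: leq_trans ij (leq_ord j).
    by move=> Bi; apply; exists i.
  move=> i j x Ci Cj; apply/val_inj; have [ij|ij|//] := ltngtP i j.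
    by have := lt i j x ij Ci Cj.
  by have := lt j i x ij Cj Ci.
- move=> x; have [[k kn Bk]|nB] := pselect (exists2 k, (k < n)%N & B k x).
    have ex : exists k, (k < n)%N && `[< B k x >].
      by exists k; rewrite kn; apply/asboolP.
    have [m /andP[mn /asboolP Bm] mmin] := ex_minnP ex.
    exists (inord m); rewrite /C inordK ?mn; last by rewrite ltnS ltnW.
    split => // -[j jm Bj]; have := mmin j; rewrite (ltn_trans jm mn)/=.
    by move=> /(_ (asboolT Bj)); rewrite leqNgt jm.
  by exists ord_max; rewrite /C/= ltnn; split => // -[k kn Bk]; apply: nB; exists k.
- move=> i x y iN; rewrite /C ifT; last first.
    by rewrite ltn_neqAle -ltnS ltn_ord andbT; apply: contra iN => /eqP iN; apply/eqP/val_inj.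
  move=> [Bx _] [By _]; apply: le_lt_trans (mdist_triangle cd (q i) _ _) _.
  by rewrite (mdist_sym cd x); move: Bx By; rewrite /B /mball/=; lra.
- rewrite /C/= ltnn setTD; split; [apply: h1|apply: h2]; rewrite /n.
    exact: leq_maxl.
  exact: leq_maxr.
Qed.

Variables (F : set (pprod S)) (c : R).
Hypothesis F_pairs : forall A V, rel_pair F A V -> prob mu A - prob nu V <= c.

(** Cell masses are transported along the pairs of cells whose product meets [F], and each [p i j]
    is spread over its product cell in proportion to [mu \x nu], which makes the marginals exact. A
    set [G] separated from [F] is charged only by pairs outside [E], at most [c] in total, and by
    the two exceptional cells, at most [delta] each. *)
Lemma approximate_coupling (delta : R) : 0 < delta ->
  exists lam : set (borel S * borel S) -> R,
  [/\ forall X, 0 <= lam X,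
      forall X Y, measurable X -> measurable Y -> X `&` Y = set0 ->
        lam (X `|` Y) = lam X + lam Y,
      forall A : set (borel S), measurable A -> lam (A `*` setT) = prob mu A,
      forall A : set (borel S), measurable A -> lam (setT `*` A) = prob nu A &
      forall G : set (borel S * borel S), measurable G ->
        (forall x y x' y' : S, G (x, y) -> F (x', y') -> d x x' < delta -> d y y' < delta -> False) ->
        lam G <= c + 2 * delta].
Proof.
move=> delta0; have [n [C [mC Cd Cc Cs [Cmu Cnu]]]] := small_partition delta0.
pose a (i : 'I_n.+1) := prob mu (C i); pose b (i : 'I_n.+1) := prob nu (C i).
have a0 i : 0 <= a i by exact: prob_ge0.
have b0 i : 0 <= b i by exact: prob_ge0.
pose E : {set 'I_n.+1 * 'I_n.+1} :=
  finset (fun ij => `[< exists x y, [/\ C ij.1 x, C ij.2 y & F (x, y)] >]).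
have sa : \sum_i a i = 1.
  rewrite -(probT mu) (prob_partition mu mC Cd Cc)//.
  by apply: eq_bigr => i _; rewrite setTI.
have sb : \sum_i b i = 1.
  rewrite -(probT nu) (prob_partition nu mC Cd Cc)//.
  by apply: eq_bigr => i _; rewrite setTI.
have c0 : 0 <= c.
  by have := @F_pairs set0 set0; rewrite /prob !measure0 subrr; apply; split.
have [|A|p [p0 pa pb pE]] := transport_defect (E := E) a0 b0 _ c0.
- by rewrite sa sb.
(* The union of the cells in [A] and the union of the neighbouring cells form a pair for [F], so
   [F_pairs] is the relaxed Hall condition. *)
- have [mA EA] := prob_partition_union mu mC Cd Cc A.
  have [mV EV] := prob_partition_union nu mC Cd Cc (neighbours E A).
  rewrite addrC -lerBlDr -EA -EV; apply: F_pairs; split => // x y [i iA Cx] Fxy.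
  have [j Cy] := Cc y; exists j => //; apply/neighboursP; exists i => //.
  by rewrite inE; apply/asboolP; exists x, y.
have p_le_a i j : p i j <= a i.
  by rewrite -pa (bigD1 j)//= lerDl sumr_ge0.
have p_le_b i j : p i j <= b j.
  by rewrite -pb (bigD1 i)//= lerDl sumr_ge0.
have pa0 i j : a i = 0 -> p i j = 0.
  by move=> ai; apply/eqP; rewrite eq_le p0 -ai p_le_a.
have pb0 i j : b j = 0 -> p i j = 0.
  by move=> bj; apply/eqP; rewrite eq_le p0 -bj p_le_b.
pose m : probability (borel S * borel S)%type R := (mu \x nu)%E.
have mX (A B : set (borel S)) : measurable A -> measurable B ->
    prob m (A `*` B) = prob mu A * prob nu B.
  move=> mA mB; rewrite /prob (_ : m (A `*` B) = (mu A * nu B)%E).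
    by rewrite fineM// fin_num_measure.
  exact: product_measure1E.
have mCC i j : measurable (C i `*` C j : set (borel S * borel S)) by exact: measurableX.
(* A zero denominator does no harm: [p i j] is at most [a i] and at most [b j], hence vanishes as
   well. *)
pose lam X := \sum_i \sum_j p i j / (a i * b j) * prob m (X `&` (C i `*` C j)).
have w0 i j : 0 <= p i j / (a i * b j) by rewrite divr_ge0// mulr_ge0.
exists lam; split.
- move=> X; apply: sumr_ge0 => i _; apply: sumr_ge0 => j _.
  by rewrite mulr_ge0// prob_ge0.
- move=> X Y mX' mY XY; rewrite /lam -big_split/=; apply: eq_bigr => i _.
  rewrite -big_split/=; apply: eq_bigr => j _; rewrite -mulrDr; congr (_ * _).
  rewrite setIUl probU//; [exact: measurableI|exact: measurableI|].
  by rewrite setIACA XY set0I.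
- move=> A mA; rewrite (prob_partition mu mC Cd Cc mA) /lam; apply: eq_bigr => i _.
  have [ai|ai] := eqVneq (a i) 0.
    rewrite big1 => [|j _]; last by rewrite pa0// !mul0r.
    apply/esym/eqP; rewrite eq_le prob_ge0 -ai andbT.
    by apply: prob_le; [exact: measurableI|exact: mC|exact: subIsetr].
  have mAi : measurable (A `&` C i : set (borel S)) by exact: measurableI.
  transitivity (\sum_j p i j * (prob mu (A `&` C i) / a i)).
    apply: eq_bigr => j _; rewrite -setXI setTI mX//; have [bj|bj] := eqVneq (b j) 0.
      by rewrite pb0// !mul0r.
    by rewrite -/(b j); field; rewrite ai bj.
  by rewrite -mulr_suml pa mulrC divfK.
- move=> A mA; rewrite (prob_partition nu mC Cd Cc mA) /lam exchange_big/=.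
  apply: eq_bigr => j _; have [bj|bj] := eqVneq (b j) 0.
    rewrite big1 => [|i _]; last by rewrite pb0// !mul0r.
    apply/esym/eqP; rewrite eq_le prob_ge0 -bj andbT.
    by apply: prob_le; [exact: measurableI|exact: mC|exact: subIsetr].
  have mAj : measurable (A `&` C j : set (borel S)) by exact: measurableI.
  transitivity (\sum_i p i j * (prob nu (A `&` C j) / b j)).
    apply: eq_bigr => i _; rewrite -setXI setTI mX//; have [ai|ai] := eqVneq (a i) 0.
      by rewrite pa0// !mul0r.
    by rewrite -/(a i); field; rewrite ai bj.
  by rewrite -mulr_suml pb mulrC divfK.
- move=> G mG sep.
  have term i j : p i j / (a i * b j) * prob m (G `&` (C i `*` C j)) <=
      (if (i, j) \notin E then p i j else 0) +
      (if i == ord_max then p i j else 0) + (if j == ord_max then p i j else 0).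
    have le_p : p i j / (a i * b j) * prob m (G `&` (C i `*` C j)) <= p i j.
      apply: (@le_trans _ _ (p i j / (a i * b j) * (a i * b j))).
        rewrite ler_wpM2l// -mX//.
        by apply: prob_le; [exact: measurableI|exact: mCC|exact: subIsetr].
      have [ab|ab] := eqVneq (a i * b j) 0; first by rewrite ab mulr0.
      by rewrite divfK.
    move: le_p (p0 i j); case: ifPn => [_|/negPn]; first by do 2 case: ifP => _; lra.
    rewrite inE => /asboolP[x' [y' [/= Cx' Cy' Fxy]]].
    have [->|iN] := eqVneq i ord_max; first by case: ifP => _; lra.
    have [->|jN] := eqVneq j ord_max; first by lra.
    move=> _ _; rewrite (_ : _ `&` _ = set0) ?/prob ?measure0/= ?mulr0 ?addr0//.
    apply/seteqP; split=> [[x y] [Gxy [/= Cx Cy]]|//].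
    by apply: sep Gxy Fxy _ _; [exact: Cs Cx Cx'|exact: Cs Cy Cy'].
  apply: (@le_trans _ _ (\sum_i \sum_j ((if (i, j) \notin E then p i j else 0) +
      (if i == ord_max then p i j else 0) + (if j == ord_max then p i j else 0)))).
    by apply: ler_sum => i _; apply: ler_sum => j _; exact: term.
  under eq_bigr do rewrite !big_split/=.
  rewrite !big_split/=.
  have -> : \sum_i \sum_j (if i == ord_max then p i j else 0) = a ord_max.
    rewrite (bigD1 ord_max)//= eqxx pa big1 ?addr0// => i /negbTE ->.
    by rewrite big1.
  have -> : \sum_i \sum_j (if j == ord_max then p i j else 0) = b ord_max.
    rewrite exchange_big/= (bigD1 ord_max)//= eqxx pb big1 ?addr0// => i /negbTE ->.
    by rewrite big1.
  have -> : \sum_i \sum_j (if (i, j) \notin E then p i j else 0) =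
      \sum_i \sum_(j | (i, j) \notin E) p i j.
    by apply: eq_bigr => i _; rewrite -big_mkcond.
  move: pE Cmu Cnu; rewrite -/(a _) -/(b _); lra.
Qed.

Lemma ultra_cvg01 (W : set_system nat) (u : nat -> R) : UltraFilter W ->
  (forall n, 0 <= u n <= 1) -> exists l : R, u @ W --> l.
Proof.
move=> UW u01.
have WI : (u @ W) `[0, 1]%classic.
  by apply: (@filterE _ W) => n; rewrite /= in_itv; exact: u01.
have [l [_ lcl]] := @segment_compact R 0 1 (u @ W) (fmap_proper_filter _ _) WI.
exists l => A lA; have [//|WA] := in_ultra_setVsetC (u @^-1` A) UW.
by have [y []] := lcl (~` A) A WA lA.
Qed.

Hypothesis closedF : closed F.

(** A single ultrafilter refining [\oo] makes the values on all measurable sets converge at once, so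
    finite additivity and the marginals survive. A set with margin [r] obeys the bound as soon as
    the mesh is below [r]. *)
Lemma limit_coupling : exists lam : set (borel S * borel S) -> R,
  [/\ forall X, 0 <= lam X,
      forall X Y, measurable X -> measurable Y -> X `&` Y = set0 ->
        lam (X `|` Y) = lam X + lam Y,
      forall A : set (borel S), measurable A -> lam (A `*` setT) = prob mu A,
      forall A : set (borel S), measurable A -> lam (setT `*` A) = prob nu A &
      forall (G : set (borel S * borel S)) (r : R), measurable G -> 0 < r ->
        (forall x y x' y' : S, G (x, y) -> F (x', y') -> d x x' < r -> d y y' < r -> False) ->
        lam G <= c].
Proof.
have inv0 (n : nat) : 0 < n.+1%:R^-1 :> R by [].
have [lamN hN] := choice (fun n => approximate_coupling (inv0 n)).
have [W [UW ooW]] := ultraFilterLemma (@eventually_filter).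
have lamN_le1 X n : measurable X -> 0 <= lamN n X <= 1.
  move=> mX; have [ge0 add m1 _ _] := hN n; rewrite ge0/=.
  rewrite -(probT mu) -m1// setXTT -(setUv X) add ?setICr//; last exact: measurableC.
  by rewrite lerDl.
have hl X : exists l : R, 0 <= l /\ (measurable X -> (fun n => lamN n X) @ W --> l).
  (* The value 0 on non-measurable sets keeps [lam] nonnegative everywhere. *)
  have [mX|nX] := pselect (measurable X); last by exists 0.
  have [l ul] := ultra_cvg01 UW (fun n => lamN_le1 X n mX); exists l; split => //.
  apply: (@closed_cvg nat R W _ (fun n => lamN n X) _ (@closed_ge R 0) _ l ul).
  by apply: filterE => n; have /andP[] := lamN_le1 X n mX.
have [lam hlam] := choice hl.
have cl X : measurable X -> (fun n => lamN n X) @ W --> lam X by have [] := hlam X.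
have uniq (u : nat -> R) (l l' : R) : u @ W --> l -> u @ W --> l' -> l = l'.
  by apply: cvg_unique; exact: Rhausdorff.
exists lam; split.
- by move=> X; have [] := hlam X.
- move=> X Y mX mY XY; apply: (uniq (fun n => lamN n (X `|` Y))).
    by apply: cl; exact: measurableU.
  rewrite (_ : (fun n => _) = (fun n => lamN n X + lamN n Y)).
    by apply: cvgD; exact: cl.
  by apply/funext => n; have [_ add _ _ _] := hN n; exact: add.
- move=> A mA; apply: (uniq (fun n => lamN n (A `*` setT))).
    by apply: cl; exact: measurableX.
  rewrite (_ : (fun n => _) = cst (prob mu A)); first exact: cvg_cst.
  by apply/funext => n; have [_ _ h _ _] := hN n; exact: h.
- move=> A mA; apply: (uniq (fun n => lamN n (setT `*` A))).
    by apply: cl; exact: measurableX.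
  rewrite (_ : (fun n => _) = cst (prob nu A)); first exact: cvg_cst.
  by apply/funext => n; have [_ _ _ h _] := hN n; exact: h.
- move=> G r mG r0 sep; apply/ler_addgt0Pr => e e0.
  (* Mesh below [r] makes the separation hypothesis applicable; mesh below [e / 2] absorbs the error
     of twice the mesh. *)
  have re0 : 0 < Num.min r (e / 2) by rewrite lt_min r0 divr_gt0.
  apply: (@closed_cvg nat R W _ (fun n => lamN n G) _ (@closed_le R (c + e)) _ _ (cl G mG)).
  apply: ooW; have [N _ hNr] := near_infty_natSinv_lt (PosNum re0).
  exists N => // n Nn; have := hNr n Nn; rewrite /= lt_min => /andP[nr ne].
  have [_ _ _ _ /(_ G mG) h] := hN n.
  apply: (@le_trans _ _ (c + 2 * n.+1%:R^-1)); last by move: (n.+1%:R^-1) ne => s; lra.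
  apply: h => x y x' y' Gxy Fxy xx yy.
  by apply: sep Gxy Fxy _ _; [exact: lt_trans nr|exact: lt_trans nr].
Qed.

(** The complement of [F] is the increasing union of the sets [G n], finite unions of rectangles
    with a common margin. There [pi] agrees with [lam], which is at most [c]. *)
Lemma strassen_closed : exists2 pi : probability (borel (pprod S)) R,
  coupling mu nu pi & 1 - c <= prob pi F.
Proof.
have [lam [lam0 lamU lam1 lam2 lamG]] := limit_coupling.
have [pi piE] := bimeasure_extension cd qd lam0 lamU lam1 lam2.
exists pi.
  by split=> A mA; rewrite piE// ?lam1 ?lam2// -probE.
have mF : measurable (F : set (borel (pprod S))) by exact: borel_closed.
have [U [V [r [oUV r0 sep FC]]]] := open_pprod_bigcup cd qd (closed_openC closedF).
have mU k : measurable (U k : set (borel S)) by have [? _] := oUV k; exact: borel_open.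
have mV k : measurable (V k : set (borel S)) by have [_ ?] := oUV k; exact: borel_open.
have mUV k : measurable (U k `*` V k : set (borel S * borel S)) by exact: measurableX.
have mX (A B : set (borel S)) : measurable A -> measurable B ->
  measurable (A `*` B : set (borel (pprod S))) by exact: borel_setX.
pose G n : set (S * S) := \bigcup_(k in `I_n) (U k `*` V k).
have mG n : measurable (G n : set (borel S * borel S)) by exact: bigcup_measurable.
have mG' n : measurable (G n : set (borel (pprod S))).
  by apply: bigcup_measurable => k _; exact: mX.
(* Agreement is known on rectangles only. Removing one rectangle from another leaves two disjoint
   rectangles, so by induction agreement extends to a rectangle minus a finite union of
   rectangles. *)
have piD n (A B : set (borel S)) : measurable A -> measurable B ->
    prob pi (A `*` B `\` G n) = lam (A `*` B `\` G n).
  elim: n A B => [|n IH] A B mA mB.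
    by rewrite /G II0 bigcup_set0 setD0 /prob piE.
  have disj : ((A `\` U n) `*` B `\` G n) `&` ((A `&` U n) `*` (B `\` V n) `\` G n) = set0.
    by apply/seteqP; split=> [[x y] [[[[/= _ nU] _] _] [[[/= _ Ux] _] _]]|].
  have mA' := measurableD mA (mU n); have mAI := measurableI _ _ mA (mU n).
  have mB' := measurableD mB (mV n).
  rewrite /G bigcup_ordS -/(G n) setUC -setDDl setXD setDUl probU ?lamU ?IH//;
    apply: measurableD => //; by [exact: mX|exact: measurableX].
have Gc n : prob pi (G n) <= c.
  have -> : prob pi (G n) = lam (G n).
    have := piD n setT setT measurableT measurableT; rewrite setXTT setTD probC//.
    have := lamU _ _ (mG n) (measurableC (mG n)) (setICr _).
    rewrite setUCr -setXTT lam1// probT; lra.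
  have [rn rn0 rnr] : exists2 rn, 0 < rn & forall k, (k < n)%N -> rn <= r k.
    elim: n => [|n [rn rn0 rnr]]; first by exists 1.
    exists (Num.min rn (r n)) => [|k]; first by rewrite lt_min rn0 r0.
    rewrite ltnS leq_eqVlt => /predU1P[->|kn]; first by rewrite ge_min lexx orbT.
    by rewrite ge_min rnr.
  apply: (lamG _ rn) => // x y x' y' [k kn [/= Ux Vy]] Fxy xx yy.
  have : (~` F) (x', y').
    by apply: sep Ux Vy _ _; [apply: lt_le_trans xx _|apply: lt_le_trans yy _]; exact: rnr.
  exact.
have : prob pi (~` F) <= c.
  by rewrite FC -bigcup_ordE; apply: prob_bigcup_le => //; exact: bigcup_ord_homo.
by rewrite probC//; lra.
Qed.

End strassen.

(** * Duality for an F-sigma preorder *)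

Section duality.
Context (R : realType) (S : ptopologicalType).
Variables mu nu : probability (borel S) R.
Implicit Types (Rel F : set (pprod S)).

Lemma closed_pprod_measurable F : closed F -> measurable (F : set (borel (pprod S))).
Proof. exact: borel_closed. Qed.

Lemma Fsigma_measurable Rel : Fsigma Rel -> measurable (Rel : set (borel (pprod S))).
Proof.
by move=> [F cF ->]; apply: bigcupT_measurable => n; exact: closed_pprod_measurable.
Qed.

(** The easy half of the duality: a pair that starts in [B] and ends outside [B] cannot belong to
    [Rel]. *)
Lemma coupling_lower_bound Rel (pi : probability (borel (pprod S)) R) (B : set S) :
  measurable (Rel : set (borel (pprod S))) -> coupling mu nu pi -> Rstar Rel B ->
  prob mu B - prob nu B <= 1 - prob pi Rel.
Proof.
move=> mRel [pi1 pi2] [mB BR].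
have m1 : measurable (B `*` setT : set (borel (pprod S))) by exact: borel_setX.
have m2 : measurable (setT `*` B : set (borel (pprod S))) by exact: borel_setX.
have -> : prob mu B = prob pi (B `*` setT) by rewrite /prob pi1.
have -> : prob nu B = prob pi (setT `*` B) by rewrite /prob pi2.
have sub : B `*` setT `<=` setT `*` B `|` ~` Rel.
  move=> [x y] [/= Bx _]; have [xy|xy] := pselect (Rel (x, y)); last by right.
  by left; split => //=; exact: BR xy.
have := prob_le pi m1 (measurableU _ _ m2 (measurableC mRel)) sub.
have := prob_le_U pi m2 (measurableC mRel); rewrite (probC pi mRel); lra.
Qed.

(** The value of the dual problem for [F], nonnegative because of the empty pair and decreasing in
    [F]. *)
Definition pair_gap F : R :=
  sup [set r | exists A V, rel_pair F A V /\ r = prob mu A - prob nu V].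

Lemma pair_gap_has_sup F :
  has_sup [set r | exists A V, rel_pair F A V /\ r = prob mu A - prob nu V].
Proof.
split; first by exists (prob mu set0 - prob nu set0), set0, set0; split => //; split.
exists 1 => _ [A [V [[mA mV _] ->]]].
by have := prob_le1 mu mA; have := prob_ge0 nu V; lra.
Qed.

Lemma pair_gap_ub F A V : rel_pair F A V -> prob mu A - prob nu V <= pair_gap F.
Proof. by move=> AV; apply: (sup_upper_bound (pair_gap_has_sup F)); exists A, V. Qed.

Lemma pair_gap_ge0 F : 0 <= pair_gap F.
Proof. by have := @pair_gap_ub F set0 set0; rewrite /prob !measure0 subrr; apply; split. Qed.

Lemma pair_gap_adherent F e : 0 < e ->
  exists AV : set S * set S,
    rel_pair F AV.1 AV.2 /\ pair_gap F - e < prob mu AV.1 - prob nu AV.2.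
Proof.
move=> e0; have [_ [A [V [AV ->]]] h] := sup_adherent e0 (pair_gap_has_sup F).
by exists (A, V).
Qed.

Lemma pair_gap_anti F F' : F `<=` F' -> pair_gap F' <= pair_gap F.
Proof.
move=> FF; apply/ler_addgt0Pr => e e0; have [[A V] /= [AV h]] := pair_gap_adherent F' e0.
by have := pair_gap_ub (rel_pair_sub FF AV); lra.
Qed.

(** The gaps of the [F n] decrease to [c]. Along a subsequence they are within [2^-1 ^+ k] of [c],
    which provides the summable errors required by [limsup_rel_pair]. *)
Lemma optimal_rel_pair (F : nat -> set (pprod S)) :
  {homo F : n m / (n <= m)%N >-> n `<=` m} ->
  exists A V, rel_pair (\bigcup_n F n) A V /\
    forall e, 0 < e -> exists n, pair_gap (F n) < prob mu A - prob nu V + e.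
Proof.
move=> ndF; pose c := inf [set pair_gap (F n) | n in setT].
have hinf : has_inf [set pair_gap (F n) | n in setT].
  split; first by exists (pair_gap (F 0%N)), 0%N.
  by exists 0 => _ [n _ <-]; exact: pair_gap_ge0.
have c_le n : c <= pair_gap (F n) by apply: ge_inf; [case: hinf|exists n].
have c_adh e : 0 < e -> exists n, pair_gap (F n) < c + e.
  by move=> e0; have [_ [n _ <-] h] := inf_adherent e0 hinf; exists n.
have half0 k : 0 < (2^-1 : R) ^+ k by rewrite exprn_gt0.
have [N hN] := choice (fun k => c_adh _ (half0 k)).
(* The partial sum makes [idx] nondecreasing and at least [N k]; the summand [k] makes the
   [F (idx k)] exhaust the whole union. *)
pose idx k := (\sum_(j < k.+1) N j + k)%N.
have idx_homo k l : (k <= l)%N -> (idx k <= idx l)%N.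
  move=> kl; rewrite leq_add// -!(big_mkord xpredT N).
  by rewrite [leqRHS](@big_cat_nat _ _ _ k.+1)//= leq_addr.
have N_idx k : (N k <= idx k)%N.
  by rewrite /idx big_ord_recr/= -addnA addnCA leq_addr.
have [AV hAV] := choice (fun k => pair_gap_adherent (F (idx k)) (half0 k)).
have [||||pairAV cAV] := @limsup_rel_pair R S mu nu (fun k => F (idx k)) c
    (fun k => (AV k).1) (fun k => (AV k).2).
- by move=> k l kl; apply: ndF; exact: idx_homo.
- move=> k B W BW; apply: (le_trans (pair_gap_ub BW)).
  by apply: le_trans (ltW (hN k)); apply: pair_gap_anti; exact: ndF.
- by move=> k; have [] := hAV k.
- by move=> k; have [_ h] := hAV k; have := c_le (idx k); lra.
exists (lim_sup_set (fun k => (AV k).1)), (lim_sup_set (fun k => (AV k).2)); split.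
  apply: rel_pair_sub pairAV => z [n _ Fz]; exists n => //.
  by apply: ndF Fz; rewrite leq_addl.
by move=> e e0; have [n hn] := c_adh e e0; exists n; lra.
Qed.

(** Compactness of the sets [K m] makes the image [B] of their union a countable union of closed
    sets. Transitivity puts [B] in [Rstar Rel], and reflexivity gives that [B] contains each
    [K m]. *)
Lemma rel_pair_Rstar (d : S -> S -> R) Rel A V :
  complete_metric d -> separable_space S ->
  rel_reflexive Rel -> rel_transitive Rel -> Fsigma Rel -> rel_pair Rel A V ->
  exists2 B, Rstar Rel B & prob mu A - prob nu V <= prob mu B - prob nu B.
Proof.
move=> cd sep refl trans [F cF RelE] [mA mV AV].
have [q qd] := dense_sequence cd sep.
have inv0 (n : nat) : 0 < n.+1%:R^-1 :> R by [].
have [K hK] := choice (fun m => compact_inner_regular cd qd mu mA (inv0 m)).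
pose B : set S := \bigcup_m \bigcup_n [set y | exists2 x, K m x & F n (x, y)].
have BP y : B y <-> exists m x, K m x /\ Rel (x, y).
  rewrite RelE; split=> [[m _ [n _ [x Kx Fxy]]]|[m [x [Kx [n _ Fxy]]]]].
    by exists m, x; split => //; exists n.
  by exists m => //; exists n => //; exists x.
have mB : measurable (B : set (borel S)).
  apply: bigcupT_measurable => m; apply: bigcupT_measurable => n.
  apply: borel_closed; apply: (closed_rel_image cd) => //.
  by have [] := hK m.
exists B.
  split => // x y /BP[m [z [Kz zx]]] xy; apply/BP; exists m, z; split => //.
  exact: trans zx xy.
have : prob mu A <= prob mu B.
  apply/ler_addgt0Pr => e e0; have [m me] := exists_natSinv_lt e0.
  have [_ cK KA Ke] := hK m.
  have KB : K m `<=` B by move=> x Kx; apply/BP; exists m, x; split.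
  have := prob_le mu (borel_closed cK) mB KB.
  by move: (m.+1%:R^-1) me Ke => s; lra.
have : prob nu B <= prob nu V.
  apply: prob_le => // y /BP[m [x [Kx xy]]]; apply: AV xy.
  by have [_ _ KA _] := hK m; exact: KA.
lra.
Qed.

Lemma duality Rel :
  polish R S -> rel_reflexive Rel -> rel_transitive Rel -> Fsigma Rel ->
  exists2 A : set S, Rstar Rel A &
    ((forall B : set S, Rstar Rel B -> mu B - nu B <= mu A - nu A) /\
     mu A - nu A = ereal_inf [set 1 - pi Rel | pi in couplings mu nu])%E.
Proof.
move=> [sep [d cd]] refl trans FRel; have [F cF RelE] := FRel.
have [q qd] := dense_sequence cd sep.
have mRel := Fsigma_measurable FRel.
pose G n := \bigcup_(k in `I_n) F k.
have cG n : closed (G n) by apply: closed_bigcup => [|k _]; [exact: finite_II|].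
have [A [V [AV gap]]] := optimal_rel_pair (@bigcup_ord_homo _ F).
rewrite bigcup_ordE -RelE in AV.
have [B BR ABle] := rel_pair_Rstar cd sep refl trans FRel AV.
have pE (C : set S) : Rstar Rel C -> (mu C - nu C)%E = (prob mu C - prob nu C)%:E.
  by move=> [mC _]; rewrite !probE// EFinB.
have piE (pi : probability (borel (pprod S)) R) : (1 - pi Rel)%E = (1 - prob pi Rel)%:E.
  by rewrite probE// EFinB.
have infE : ereal_inf [set (1 - pi Rel)%E | pi in couplings mu nu] = (mu B - nu B)%E.
  apply/eqP; rewrite eq_le; apply/andP; split; last first.
    apply: le_ereal_inf_tmp => _ [pi cpi <-]; rewrite pE// piE lee_fin.
    exact: coupling_lower_bound.
  (* The coupling depends on [e]: it is optimal for a closed [G n] whose gap is within [e] of the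
     value at [(A, V)], and [Rel] contains [G n]. *)
  apply/lee_addgt0Pr => e e0; have [n hn] := gap e e0.
  have [pi cpi piG] := strassen_closed cd qd (@pair_gap_ub (G n)) (cG n).
  apply: (@le_trans _ _ (1 - pi Rel)%E).
    by apply: ereal_inf_lbound; exists pi.
  rewrite pE// piE -EFinD lee_fin.
  have : prob pi (G n) <= prob pi Rel.
    apply: prob_le => //; first exact: closed_pprod_measurable.
    by rewrite RelE => z [k _ Fz]; exists k.
  rewrite -/(G n) in hn; lra.
exists B => //; split => // C CR; rewrite -infE; apply: le_ereal_inf_tmp => _ [pi cpi <-].
by rewrite pE// piE lee_fin; exact: coupling_lower_bound.
Qed.

End duality.

(** * A preorder for which the infimum is not attained *)

Section non_attainment.
Variable R : realType.

Lemma real_complete_metric : complete_metric (fun x y : R => `|x - y|).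
Proof.
split.
- move=> x y; split=> [/eqP|->]; last by rewrite subrr normr0.
  by rewrite normr_eq0 subr_eq0 => /eqP.
- by move=> x y; rewrite distrC.
- by move=> x y z; exact: ler_distD.
- move=> A; split=> [oA x Ax|h].
    have /nbhs_ballP[e /= e0 eA] := open_nbhs_nbhs (conj oA Ax).
    by exists e => // y; rewrite -ball_normE in eA; exact: eA.
  rewrite openE => x Ax; have [e e0 eA] := h x Ax.
  by apply/nbhs_ballP; exists e => //; rewrite -ball_normE.
- move=> u cu.
  have cF : cauchy (u @ \oo).
    apply/cauchy_exP => e e0; have [N hN] := cu e e0; exists (u N).
    by exists N => // n /= Nn; rewrite -ball_normE /=; exact: hN.
  have ucvg : cvg (u @ \oo) by exact: cauchy_cvg.
  exists (lim (u @ \oo)) => e e0.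
  have /cvgrPdist_lt/(_ e e0)[N _ hN] := ucvg; exists N => n Nn.
  by rewrite distrC; exact: hN.
Qed.

Lemma real_polish : polish R R.
Proof.
split; last by exists (fun x y => `|x - y|); exact: real_complete_metric.
exists (range ratr); split; last exact: dense_rat.
exact: card_le_trans (card_image_le _ _) (countableP _).
Qed.

Lemma closed_pprod_of_approx (S : ptopologicalType) (d : S -> S -> R) (F : set (pprod S)) :
  complete_metric d ->
  (forall x y, (forall e, 0 < e ->
     exists x' y', [/\ F (x', y'), d x x' < e & d y y' < e]) -> F (x, y)) ->
  closed F.
Proof.
move=> cd h [x y] xycl; apply: h => e e0.
have [|[x' y'] [Fxy [/= xx yy]]] := xycl (mball d x e `*` mball d y e).
  by apply/(nbhs_pprodP cd); exists e.
by exists x', y'.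
Qed.

(** Sources lie in [x <= 1] and targets in [2 <= y], so two non-trivial steps never compose and
    transitivity is immediate. The strict inequality keeps the relation from being closed. *)
Definition shift_rel : set (pprod R) :=
  [set z | z.1 = z.2 \/ [/\ z.1 <= 1, 2 <= z.2 & z.1 + 2 < z.2]].

Lemma shift_rel_reflexive : rel_reflexive shift_rel.
Proof. by move=> x; left. Qed.

Lemma shift_rel_transitive : rel_transitive shift_rel.
Proof.
move=> x y z [/= ->//|[x1 y2 xy]] [/= <-|[y1 z2 yz]]; first by right.
by right; split => //=; lra.
Qed.

Lemma shift_rel_Fsigma : Fsigma shift_rel.
Proof.
(* Index 0 is the diagonal; the strict inequality is exhausted by weak ones with margin
   [1 / (k + 1)]. *)
exists (fun n => if n is k.+1 then
    [set z | [/\ z.1 <= 1, 2 <= z.2 & z.1 + 2 + k.+1%:R^-1 <= z.2]]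
  else [set z | z.1 = z.2]).
  case=> [|k]; apply: (closed_pprod_of_approx real_complete_metric) => x y h /=.
    apply/eqP; rewrite -subr_eq0 -normr_eq0 eq_le normr_ge0 andbT.
    apply/ler_addgt0Pr => e e0; rewrite add0r.
    have [|x' [y' [/= <- xx yx]]] := h (e / 2); first by rewrite divr_gt0.
    have := ler_distD x' x y; rewrite (distrC x' y); lra.
  have near e : 0 < e -> exists x' y', [/\ x' <= 1, 2 <= y', x' + 2 + k.+1%:R^-1 <= y',
      x - e < x' < x + e & y - e < y' < y + e].
    move=> /h[x' [y' [/= [x1 y2 xy]]]].
    by rewrite distrC => + ; rewrite ltr_distl => xx; rewrite distrC ltr_distl => yy; exists x', y'.
  split; apply/ler_addgt0Pr => e e0.
  - by have [x' [y' []]] := near e e0; lra.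
  - by have [x' [y' []]] := near e e0; lra.
  - have [|x' [y' []]] := near (e / 2); first by rewrite divr_gt0.
    by move: (k.+1%:R^-1) => s; lra.
apply/seteqP; split=> [[x y] [/= xy|[/= x1 y2 xy]]|[x y] [[|k] _ /=]].
- by exists 0%N.
- have [|k hk] := @exists_natSinv_lt R (y - (x + 2)); first by rewrite subr_gt0.
  by exists k.+1 => //=; split => //; move: (k.+1%:R^-1) hk => s; lra.
- by left.
- move=> [x1 y2 xy]; right; split => //=; apply: lt_le_trans xy; rewrite ltrDl//.
Qed.

Let U01 : probability (measurableTypeR R) R := uniform_prob (@ltr01 R).

Let U01_itv (A : set R) : measurable A -> U01 A = U01 (A `&` `[0, 1]).
Proof.
by move=> mA; rewrite /U01/= /uniform_prob integral_uniform_pdf.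
Qed.

Let U01_point (a : R) : U01 [set a] = 0%E.
Proof.
have /null_content_dominatesP h := @dominates_uniform_prob R 0 1 ltr01.
by apply: h; [exact: measurable_set1|exact: lebesgue_measure_set1].
Qed.

Let open_real_measurable (G : set R) : open G -> measurable (G : set (measurableTypeR R)).
Proof. exact: open_measurable. Qed.

Lemma half_line_borel (q : R) : measurable ([set x | q < x] : set (borel R)).
Proof. by apply: borel_open; exact: open_gt. Qed.

(** The uniform law on the unit interval and its translate by 2, reduced to what the counterexample
    uses: the supports, the equality of tails, and the absence of atoms. *)
Lemma shifted_uniforms : exists mu nu : probability (borel R) R,
  [/\ prob mu [set x | x <= 1] = 1, prob nu [set y | 2 <= y] = 1,
      (forall q, prob nu [set y | q + 2 < y] = prob mu [set x | q < x]) &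
      forall a, prob mu [set x | a <= x] = prob mu [set x | a < x]].
Proof.
have mf : measurable_fun setT (id : measurableTypeR R -> borel R).
  by apply: measurable_fun_borel => G oG; exact: open_real_measurable.
have mg : measurable_fun setT (fun x : measurableTypeR R => (x + 2 : borel R)).
  apply: measurable_fun_borel => G /open_real_measurable mG.
  have m2 : measurable_fun setT (fun x : measurableTypeR R => x + 2 : measurableTypeR R).
    exact: measurable_funD.
  by have := m2 measurableT G mG; rewrite setTI.
have [mu mu_img] := pushforward_probability mf (probability_setT U01).
have [nu nu_img] := pushforward_probability mg (probability_setT U01).
have hmu (A : set R) : mu A = U01 A by exact: mu_img.
have hnu (A : set R) : nu A = U01 [set x | A (x + 2)] by exact: nu_img.
have U1 (A : set R) : measurable (A : set (measurableTypeR R)) -> `[0, 1] `<=` A -> U01 A = 1%E.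
  move=> mA sA; rewrite U01_itv// (setIidr sA) -(setTI `[0, 1]%classic) -U01_itv//.
  exact: probability_setT.
have mle (a : R) : measurable ([set x | x <= a] : set (measurableTypeR R)).
  by rewrite -set_itvNyc; exact: measurable_itv.
have mge (a : R) : measurable ([set x | a <= x] : set (measurableTypeR R)).
  by rewrite -set_itvcy; exact: measurable_itv.
have mgt (a : R) : measurable ([set x | a < x] : set (measurableTypeR R)).
  by rewrite -set_itvoy; exact: measurable_itv.
exists mu, nu; split.
- by rewrite /prob hmu U1// => x /=; rewrite in_itv/= => /andP[].
- have -> : prob nu [set y | 2 <= y] = fine (U01 [set x | 0 <= x]).
    rewrite /prob hnu; congr (fine (U01 _)).
    by apply/seteqP; split=> x /=; rewrite lerDr.
  by rewrite U1// => x /=; rewrite in_itv/= => /andP[].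
- move=> q; rewrite /prob hnu hmu; congr (fine (U01 _)).
  by apply/seteqP; split=> x /=; rewrite ltrD2r.
- move=> a; rewrite /prob !hmu; congr fine.
  rewrite (_ : [set x | a <= x] = [set x | a < x] `|` [set a]).
    rewrite measureU//; [by rewrite [X in (_ + X)%E]U01_point adde0|].
    by apply/seteqP; split=> [x [/= ax xa]|//]; rewrite xa ltxx in ax.
  apply/seteqP; split=> [x /=|x /= [|->//]]; last exact: ltW.
  by rewrite le_eqVlt => /predU1P[->|ax]; [right|left].
Qed.

(** By duality the infimum is [mu A - nu A] for some [A], and this is at most 0, so an optimal
    coupling would satisfy [x + 2 < y] almost surely. Then, for rational [r], the event [x <= r],
    [r + 2 < y] is null, as the tails of the marginals have equal mass; these events cover
    [x + 2 < y], a contradiction. *)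
Lemma shift_rel_not_attained : exists mu nu : probability (borel R) R,
  ~ (exists2 pi, coupling mu nu pi &
       (1 - pi shift_rel = ereal_inf [set 1 - p shift_rel | p in couplings mu nu])%E).
Proof.
have [mu [nu [mu1 nu2 nu_mu atomless]]] := shifted_uniforms.
exists mu, nu => -[pi cpi].
have mle (a : R) : measurable ([set x | x <= a] : set (borel R)).
  by apply: borel_closed; exact: closed_le.
have mge (a : R) : measurable ([set x | a <= x] : set (borel R)).
  by apply: borel_closed; exact: closed_ge.
have mgt := half_line_borel.
have mRel := Fsigma_measurable shift_rel_Fsigma.
have [A [mA AR] [_ AE]] := duality mu nu real_polish shift_rel_reflexive
  shift_rel_transitive shift_rel_Fsigma.
(* Up to a [mu]-null set [A] is [A1]. Each [x] in [A1] forces into [A] every [y >= 2] with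
   [x + 2 < y], so [A] contains a half-line whose [nu]-mass is at least the mass of [A1]. *)
have muA : prob mu A <= prob nu A.
  pose A1 := A `&` [set x | x <= 1].
  have mA1 : measurable (A1 : set (borel R)) by exact: measurableI.
  have -> : prob mu A = prob mu A1.
    have := probID mu mA (mle 1).
    have : prob mu (A `\` [set x | x <= 1]) <= prob mu (~` [set x | x <= 1]).
      by apply: prob_le; [exact: measurableD|exact: measurableC|move=> x []].
    by have := prob_ge0 mu (A `\` [set x | x <= 1]); rewrite probC// mu1 /A1; lra.
  have le_gt a : A1 `<=` [set x | a <= x] ->
      [set y | a + 2 < y] `&` [set y | 2 <= y] `<=` A -> prob mu A1 <= prob nu A.
    move=> A1a aA; apply: (le_trans (prob_le mu mA1 (mge a) A1a)).
    rewrite atomless -nu_mu (probID nu (mgt _) (mge 2)).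
    have : prob nu ([set y | a + 2 < y] `\` [set y | 2 <= y]) <= prob nu (~` [set y | 2 <= y]).
      by apply: prob_le; [exact: measurableD|exact: measurableC|move=> x []].
    have := prob_le nu (measurableI _ _ (mgt (a + 2)) (mge 2)) mA aA.
    by rewrite probC// nu2; lra.
  have lower a : (exists2 x, A1 x & x <= a) ->
      [set y | a + 2 < y] `&` [set y | 2 <= y] `<=` A.
    by move=> [x [Ax x1] xa] y [/= ay y2]; apply: AR Ax _; right; split => //=; lra.
  have [A1lb|A1nlb] := pselect (has_lbound A1); last first.
    have : [set y | 2 <= y] `<=` A.
      move=> y y2; apply: contrapT => Ay; apply: A1nlb; exists (y - 2) => x A1x.
      rewrite leNgt; apply/negP => xy; apply: Ay; apply: (lower x); first by exists x.
      by split => //=; lra.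
    move=> /(prob_le nu (mge 2) mA); rewrite nu2.
    by have := prob_le1 mu mA1; lra.
  have [A10|A1n0] := pselect (A1 !=set0); last first.
    have -> : A1 = set0 by apply/seteqP; split => // x A1x; apply: A1n0; exists x.
    by rewrite {1}/prob measure0 prob_ge0.
  (* The infimum may fail to be attained, so only the open half-line above [inf A1 + 2] is obtained;
     [atomless] makes up for the missing endpoint. *)
  apply: (le_gt (inf A1)); first by move=> x A1x; exact: ge_inf.
  move=> y [/= iy y2]; have [|x A1x xi] := @inf_adherent _ A1 ((y - (inf A1 + 2))) _ (conj A10 A1lb).
    by rewrite subr_gt0.
  by apply: (lower x); [exists x|split => //=; lra].
have mA' : measurable (A : set (borel R)) by [].
rewrite -AE (probE mu mA') (probE nu mA') (probE pi mRel) -!EFinB => -[piE].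
have [pi1 pi2] := cpi.
have X1 : prob pi ([set x | x <= 1] `*` setT) = 1 by rewrite -[RHS]mu1 /prob pi1.
have Y2 : prob pi (setT `*` [set y | 2 <= y]) = 1 by rewrite -[RHS]nu2 /prob pi2.
pose Z (r : rat) : set (R * R) := [set x | x <= ratr r] `*` [set y | ratr r + 2 < y].
have mZ r : measurable (Z r : set (borel (pprod R))) by exact: borel_setX.
pose D : set (R * R) := \bigcup_r Z r.
have DP x y : D (x, y) <-> x + 2 < y.
  split=> [[r _ [/= xr ry]]|xy]; first lra.
  have [|r] := @rat_in_itvoo R x (y - 2); first lra.
  by rewrite in_itv/= => /andP[xr ry]; exists r => //; split => /=; lra.
have mD : measurable (D : set (borel (pprod R))).
  by apply: countable_bigcupT_measurable.
have mX : measurable ([set x | x <= 1] `*` setT : set (borel (pprod R))) by exact: borel_setX.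
have mY : measurable (setT `*` [set y | 2 <= y] : set (borel (pprod R))) by exact: borel_setX.
have D1 : prob pi (~` D) <= 0.
  (* Where [x <= 1] and [2 <= y] the diagonal is excluded, so [shift_rel] forces [x + 2 < y]
     there. *)
  have sub : ~` D `<=` (~` shift_rel `|` ~` ([set x | x <= 1] `*` setT)) `|` ~` (setT `*` [set y | 2 <= y]).
    move=> [x y] nD; apply: contrapT => h; apply: nD; apply/DP.
    have [xy|xy] : shift_rel (x, y) by apply: contrapT => h'; apply: h; left; left.
      have x1 : x <= 1.
        by apply: contrapT => h'; apply: h; left; right => -[].
      have y2 : 2 <= y by apply: contrapT => h'; apply: h; right => -[].
      by move: xy => /=; lra.
    by case: xy.
  have := prob_le pi (measurableC mD) (measurableU _ _ (measurableU _ _ (measurableC mRel) (measurableC mX)) (measurableC mY)) sub.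
  have := prob_le_U pi (measurableU _ _ (measurableC mRel) (measurableC mX)) (measurableC mY).
  have := prob_le_U pi (measurableC mRel) (measurableC mX).
  by rewrite !probC// X1 Y2; lra.
have Z0 r : prob pi (Z r) <= 0.
  pose W : set (R * R) := [set x | ratr r < x] `*` [set y | ratr r + 2 < y].
  have mW : measurable (W : set (borel (pprod R))) by exact: borel_setX.
  have mX' : measurable ([set x | ratr r < x] `*` setT : set (borel (pprod R))) by exact: borel_setX.
  have -> : prob pi (Z r) = prob pi (setT `*` [set y | ratr r + 2 < y]) - prob pi W.
    rewrite (_ : setT `*` _ = Z r `|` W).
      rewrite probU ?addrK//; apply/seteqP; split=> [[x y] [[/= xr _] [/= rx _]]|//]; lra.
    apply/seteqP; split=> [[x y] [_ /= ry]|[x y] [[_ ?]|[_ ?]]] //.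
    by have [xr|rx] := leP x (ratr r); [left|right].
  have -> : prob pi (setT `*` [set y | ratr r + 2 < y]) = prob mu [set x | ratr r < x].
    by rewrite -nu_mu /prob pi2.
  have -> : prob mu [set x | ratr r < x] = prob pi ([set x | ratr r < x] `*` setT).
    by rewrite /prob pi1.
  have sub : [set x | ratr r < x] `*` setT `<=` W `|` ~` D.
    move=> [x y] [/= rx _]; have [ry|yr] := ltP (ratr r + 2) y; first by left.
    by right => /DP; lra.
  have := prob_le pi mX' (measurableU _ _ mW (measurableC mD)) sub.
  by have := prob_le_U pi mW (measurableC mD); lra.
pose Zn n : set (R * R) := if (unpickle n : option rat) is Some r then Z r else set0.
have DE : D = \bigcup_n Zn n.
  apply/seteqP; split=> [z [r _ Zr]|z [n _]].
    by exists (pickle r); [exact: I|rewrite /Zn pickleK].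
  by rewrite /Zn; case: unpickle => // r Zr; exists r.
have : prob pi D <= 0.
  rewrite DE; apply: prob_bigcup_geometric => n; rewrite /Zn; case: unpickle => // [r|].
    by rewrite mul0r.
  by rewrite mul0r /prob measure0.
by move: D1; rewrite probC//; lra.
Qed.

End non_attainment.

Unset Implicit Arguments.
Local Open Scope ereal_scope.

Theorem theorem1p1 (R : realType) :
  (forall (S : ptopologicalType), polish R S ->
   forall Rel : set (pprod S),
     rel_reflexive Rel -> rel_transitive Rel -> Fsigma Rel ->
   forall mu nu : probability (borel S) R,
     exists2 A : set S, Rstar Rel A &
       (forall B : set S, Rstar Rel B -> mu B - nu B <= mu A - nu A) /\
       mu A - nu A =
         ereal_inf [set 1 - pi Rel | pi in couplings mu nu])
  /\
  (exists (S : ptopologicalType) (Rel : set (pprod S))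
          (mu nu : probability (borel S) R),
     [/\ polish R S, rel_reflexive Rel, rel_transitive Rel, Fsigma Rel &
       ~ (exists2 pi, coupling mu nu pi &
            1 - pi Rel = ereal_inf [set 1 - p Rel | p in couplings mu nu])]).
Proof.
split=> [S pS Rel refl trans FRel mu nu|]; first exact: duality.
have [mu [nu not_attained]] := shift_rel_not_attained R.
exists R, (@shift_rel R), mu, nu; split => //.
- exact: real_polish.
- exact: shift_rel_reflexive.
- exact: shift_rel_transitive.
- exact: shift_rel_Fsigma.
Qed.
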